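(* Let $p\in\omega^*$ be a selective ultrafilter. Then $(\mathsf{Ult}_p^{\omega_1}([\omega]^{<\omega}),\tau_{\overline{\mathrm{Bohr}}})$ is a Hausdorff $p$-compact topological Boolean group without non-trivial convergent sequences.
   Context: $\omega^*$ is the set of nonprincipal ultrafilters on $\omega$. An ultrafilter $p\in\omega^*$ is a P-point if every function on $\omega$ is finite-to-one or constant when restricted to some set in $p$; it is a Q-point if every finite-to-one function on $\omega$ becomes one-to-one when restricted to some set in $p$; it is selective if it is both a P-point and a Q-point. $[\omega]^{<\omega}$ is the group of finite subsets of $\omega$ under symmetric difference, with neutral element $\varnothing$. A Boolean group is a group in which each element is its own inverse. For a point $x$ and a sequence $\langle x_n: n\in\omega\rangle$ in a space $X$, $x=p\text{-}\lim_{n\in\omega}x_n$ means that $\{n\in\omega: x_n\in U\}\in p$ for every open $U\ni x$. $X$ is $p$-compact if every sequence $\langle x_n:n\in\omega\rangle$ in $X$ has a $p$-limit in $X$. For a group $\mathbb{G}$, $\mathsf{ult}_p(\mathbb{G})=\mathbb{G}^\omega/\equiv$, where $f\equiv g$ iff $\{n: f(n)=g(n)\}\in p$, with the group operation induced pointwise; $[f]$ denotes the class of $f$. Iterated ultrapowers: $\mathsf{ult}_p^0(\mathbb{G})=\mathbb{G}$, and for an ordinal $\alpha>0$, $\mathsf{ult}_p^\alpha(\mathbb{G})=\mathsf{ult}_p\big(\varinjlim_{\beta<\alpha}\mathsf{ult}_p^\beta(\mathbb{G})\big)$. The direct limit is taken along the canonical embeddings $\varphi_{\delta\beta}:\mathsf{ult}_p^\delta(\mathbb{G})\to\mathsf{ult}_p^\beta(\mathbb{G})$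 ($\delta\le\beta<\alpha$), where $\varphi_{\delta\delta}$ is the identity and, for $\delta<\beta$, $\varphi_{\delta\beta}$ sends $x$ to the class of the constant function whose value is the image of $x$ in $\varinjlim_{\gamma<\beta}\mathsf{ult}_p^\gamma(\mathbb{G})$. Each $\Phi\in\mathrm{Hom}(\mathbb{G},\mathbb{T})$ ($\mathbb{T}$ the circle group) extends recursively to a homomorphism $\overline{\Phi}$ on all $\mathsf{ult}_p^\alpha(\mathbb{G})$, $\alpha\le\omega_1$, by $\overline{\Phi}([f])=p\text{-}\lim_{n\in\omega}\overline{\Phi}(f(n))$, starting with $\overline{\Phi}=\Phi$ on $\mathbb{G}$. (For $\mathbb{G}=[\omega]^{<\omega}$, $\mathrm{Hom}(\mathbb{G},\mathbb{T})$ is identified with $\mathrm{Hom}([\omega]^{<\omega},2)$, $2=\{0,1\}$ the two-element group.) $\tau_{\overline{\mathrm{Bohr}}}$ on $\mathsf{ult}_p^{\omega_1}(\mathbb{G})$ is the weakest topology making every $\overline{\Phi}$, $\Phi\in\mathrm{Hom}(\mathbb{G},\mathbb{T})$, continuous. With $K=\bigcap_{\Phi\in\mathrm{Hom}(\mathbb{G},\mathbb{T})}\mathrm{Ker}(\overline{\Phi})$, put $\mathsf{Ult}_p^{\omega_1}(\mathbb{G})=\mathsf{ult}_p^{\omega_1}(\mathbb{G})/K$ with the quotient topology, again denoted $\tau_{\overline{\mathrm{Bohr}}}$. A convergent sequence is non-trivial if it is not eventually constant. *)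

(* Defs.v *)
From HB Require Import structures.
From mathcomp Require Import all_boot all_order all_algebra finmap.
From mathcomp Require Import generic_quotient ring_quotient archimedean.
From mathcomp Require Import all_classical all_reals all_analysis.
From mathcomp Require Import lra wochoice.
Set Implicit Arguments.
Unset Strict Implicit.
Unset Printing Implicit Defensive.
Import Order.TTheory GRing.Theory Num.Theory numFieldNormedType.Exports.
Local Open Scope classical_set_scope.
Local Open Scope order_scope.
Local Open Scope ring_scope.
Local Open Scope quotient_scope.

Record omega_star := OmegaStar {
  ultra :> set_system nat;
  ultra_filter : UltraFilter ultra;
  ultra_nonprincipal : forall n : nat, ~ ultra [set n] }.

#[global] Instance omega_star_proper (p : omega_star) : ProperFilter p :=
  @ultra_proper _ _ (ultra_filter p).

Definition finite_to_one (A : set nat) (f : nat -> nat) :=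
  forall m, finite_set (A `&` f @^-1` [set m]).

Definition p_point (p : omega_star) :=
  forall f : nat -> nat, exists2 A, ultra p A &
    finite_to_one A f \/ (forall m n, A m -> A n -> f m = f n).

Definition q_point (p : omega_star) :=
  forall f : nat -> nat, finite_to_one setT f -> exists2 A, ultra p A & set_inj A f.

Definition selective (p : omega_star) := p_point p /\ q_point p.

Definition fin_omega : Type := {fset nat}.
HB.instance Definition _ := Choice.on fin_omega.

Section FinOmega.
Local Open Scope fset_scope.

Definition symdiff (A B : fin_omega) : fin_omega := (A `\` B) `|` (B `\` A).

Lemma in_symdiff n A B : (n \in symdiff A B) = (n \in A) (+) (n \in B).
Proof. by rewrite /symdiff !inE; case: (n \in A); case: (n \in B). Qed.

Lemma symdiffA : associative symdiff.
Proof. by move=> A B C; apply/fsetP => n; rewrite !in_symdiff addbA. Qed.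

Lemma symdiffC : commutative symdiff.
Proof. by move=> A B; apply/fsetP => n; rewrite !in_symdiff addbC. Qed.

Lemma symdiff0 : left_id (fset0 : fin_omega) symdiff.
Proof. by move=> A; apply/fsetP => n; rewrite in_symdiff inE. Qed.

Lemma symdiffN : left_inverse (fset0 : fin_omega) id symdiff.
Proof. by move=> A; apply/fsetP => n; rewrite in_symdiff addbb inE. Qed.

HB.instance Definition _ :=
  GRing.isZmodule.Build fin_omega symdiffA symdiffC symdiff0 symdiffN.

End FinOmega.

Section Ultrapower.
Variables (p : omega_star) (H : zmodType).

Definition eq_mod (f g : nat -> H) : bool := `[< ultra p [set n | f n = g n] >].

Lemma eq_mod_equiv : equiv_class_of eq_mod.
Proof.
split=> [f|f g|g f h].
- by apply/asboolP; apply: filterS filterT => n.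
- by apply/asboolP/asboolP; apply: filterS => n /= ->.
- move=> /asboolP fg /asboolP gh; apply/asboolP.
  by apply: filterS2 fg gh => n /= -> ->.
Qed.

Canonical eq_mod_equivRel := EquivRelPack eq_mod_equiv.
Canonical eq_mod_encModRel := defaultEncModRel eq_mod.

Definition ult : Type := {eq_quot eq_mod}.
HB.instance Definition _ := EqQuotient.on ult.
HB.instance Definition _ := Choice.on ult.

Definition ult_class (f : nat -> H) : ult := \pi_ult f.

Lemma ult_eqP f g : reflect (ultra p [set n | f n = g n]) (ult_class f == ult_class g).
Proof. by rewrite /ult_class piE; apply: asboolP. Qed.

Definition ult_zero : ult := ult_class (fun=> 0).
Definition ult_opp (x : ult) : ult := ult_class (fun n => - repr x n).
Definition ult_add (x y : ult) : ult := ult_class (fun n => repr x n + repr y n).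

Lemma ult_repr f : ultra p [set n | repr (ult_class f) n = f n].
Proof. by apply/ult_eqP; rewrite /ult_class reprK. Qed.

Lemma ult_addE f g :
  ult_add (ult_class f) (ult_class g) = ult_class (fun n => f n + g n).
Proof.
by apply/eqP/ult_eqP; apply: filterS2 (ult_repr f) (ult_repr g) => n /= -> ->.
Qed.

Lemma ult_oppE f : ult_opp (ult_class f) = ult_class (fun n => - f n).
Proof. by apply/eqP/ult_eqP; apply: filterS (ult_repr f) => n /= ->. Qed.

Lemma ult_classP (x : ult) : exists f, x = ult_class f.
Proof. by exists (repr x); rewrite /ult_class reprK. Qed.

Lemma ult_addA : associative ult_add.
Proof.
move=> x y z; have [f ->] := ult_classP x; have [g ->] := ult_classP y.
have [h ->] := ult_classP z; rewrite !ult_addE.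
by congr ult_class; apply/funext => n; rewrite addrA.
Qed.

Lemma ult_addC : commutative ult_add.
Proof.
move=> x y; have [f ->] := ult_classP x; have [g ->] := ult_classP y.
by rewrite !ult_addE; congr ult_class; apply/funext => n; rewrite addrC.
Qed.

Lemma ult_add0 : left_id ult_zero ult_add.
Proof.
move=> x; have [f ->] := ult_classP x; rewrite ult_addE.
by congr ult_class; apply/funext => n; rewrite add0r.
Qed.

Lemma ult_addN : left_inverse ult_zero ult_opp ult_add.
Proof.
move=> x; have [f ->] := ult_classP x; rewrite ult_oppE ult_addE.
by congr ult_class; apply/funext => n; rewrite addNr.
Qed.

HB.instance Definition _ :=
  GRing.isZmodule.Build ult ult_addA ult_addC ult_add0 ult_addN.

Lemma ult_classD f g : ult_class (fun n => f n + g n) = ult_class f + ult_class g.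
Proof. by rewrite -ult_addE. Qed.

End Ultrapower.

Record dsystem d (I : tbOrderType d) := DSystem {
  dgrp :> I -> zmodType;
  demb : forall a b : I, (a <= b)%O -> {additive dgrp a -> dgrp b};
  demb_id : forall a (aa : (a <= a)%O) x, demb aa x = x;
  demb_comp : forall a b c (ab : (a <= b)%O) (bc : (b <= c)%O) (ac : (a <= c)%O) x,
    demb bc (demb ab x) = demb ac x }.

Section DirectLimit.
Variables (d : Order.disp_t) (I : tbOrderType d) (S : dsystem I) (a : I).

Definition below : Type := {x : {b : I & S b} | (tag x < a)%O}.
HB.instance Definition _ := Choice.on below.

Definition eq_lim (x y : below) : bool :=
  `[< exists c (xc : (tag (val x) <= c)%O) (yc : (tag (val y) <= c)%O),
        (c < a)%O /\ demb S xc (tagged (val x)) = demb S yc (tagged (val y)) >].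

Lemma eq_lim_equiv : equiv_class_of eq_lim.
Proof.
split=> [x|x y|y x z].
- apply/asboolP; exists (tag (val x)), (lexx _), (lexx _).
  by split=> //; exact: (valP x).
- by apply/asboolP/asboolP => -[c [xc [yc [ca e]]]]; exists c, yc, xc.
- move=> /asboolP[c [xc [yc [ca e]]]] /asboolP[c' [yc' [zc' [ca' e']]]].
  have cm : (c <= Order.max c c')%O by rewrite le_max lexx.
  have c'm : (c' <= Order.max c c')%O by rewrite le_max lexx orbT.
  apply/asboolP; exists (Order.max c c'), (le_trans xc cm), (le_trans zc' c'm).
  rewrite gt_max ca ca'; split=> //.
  rewrite -(demb_comp xc cm) e -(demb_comp zc' c'm) -e'.
  by rewrite (demb_comp yc cm (le_trans yc cm)) (demb_comp yc' c'm (le_trans yc cm)).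
Qed.

Canonical eq_lim_equivRel := EquivRelPack eq_lim_equiv.
Canonical eq_lim_encModRel := defaultEncModRel eq_lim.

(* The positivity of a makes the index set inhabited, as the zero of the limit
   requires. *)
Definition dirlim (a0 : (\bot < a)%O) : Type := {eq_quot eq_lim}.

Variable a0 : (\bot < a)%O.
HB.instance Definition _ := EqQuotient.on (dirlim a0).
HB.instance Definition _ := Choice.on (dirlim a0).

Definition lim_class (x : below) : dirlim a0 := \pi_(dirlim a0) x.

Definition dlim (b : I) (ba : (b < a)%O) (x : S b) : dirlim a0 :=
  lim_class (exist _ (existT _ b x) ba).

Lemma lim_classE x : lim_class x = dlim (valP x) (tagged (val x)).
Proof. by rewrite {1}/lim_class; congr lim_class; apply: val_inj; rewrite /=; case: (val x). Qed.

Lemma dlimP z : exists b (ba : (b < a)%O) x, z = dlim ba x.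
Proof.
exists (tag (val (repr z))), (valP (repr z)), (tagged (val (repr z))).
by rewrite -lim_classE /lim_class reprK.
Qed.

Lemma dlim_emb b c (bc : (b <= c)%O) (ba : (b < a)%O) (ca : (c < a)%O) x :
  dlim ba x = dlim ca (demb S bc x).
Proof.
apply/eqP; rewrite /dlim /lim_class piE; apply/asboolP.
by exists c, bc, (lexx c); rewrite demb_id.
Qed.

Lemma dlim_eq b c (ba : (b < a)%O) (ca : (c < a)%O) x y :
  dlim ba x = dlim ca y -> exists e (be : (b <= e)%O) (ce : (c <= e)%O),
    (e < a)%O /\ demb S be x = demb S ce y.
Proof. by move=> /eqP; rewrite /dlim /lim_class piE => /asboolP. Qed.

Definition lim_zero : dirlim a0 := dlim a0 0.
Definition lim_opp (x : dirlim a0) : dirlim a0 :=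
  let u := repr x in dlim (valP u) (- tagged (val u)).

Lemma max_below (x y : below) : (Order.max (tag (val x)) (tag (val y)) < a)%O.
Proof. by rewrite gt_max (valP x) (valP y). Qed.

Lemma le_maxl (b c : I) : (b <= Order.max b c)%O.
Proof. by rewrite le_max lexx. Qed.

Lemma le_maxr (b c : I) : (c <= Order.max b c)%O.
Proof. by rewrite le_max lexx orbT. Qed.

Definition lim_add (x y : dirlim a0) : dirlim a0 :=
  let u := repr x in let v := repr y in
  dlim (max_below u v) (demb S (le_maxl _ _) (tagged (val u))
                        + demb S (le_maxr _ _) (tagged (val v))).

Lemma lim_addE b (ba : (b < a)%O) x y :
  lim_add (dlim ba x) (dlim ba y) = dlim ba (x + y).
Proof.
rewrite /lim_add; set u := repr _; set v := repr _.
have := reprK (dlim ba x); rewrite -/u -[\pi u]/(lim_class u) lim_classE.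
move=> /dlim_eq[c [uc [bc [ca eu]]]].
have := reprK (dlim ba y); rewrite -/v -[\pi v]/(lim_class v) lim_classE.
move=> /dlim_eq[c' [vc' [bc' [ca' ev]]]].
pose m := Order.max (Order.max c c') (Order.max (tag (val u)) (tag (val v))).
have cm : (c <= m)%O by rewrite !le_max lexx.
have cm' : (c' <= m)%O by rewrite !le_max lexx orbT.
have ma : (m < a)%O by rewrite !gt_max ca ca' (valP u) (valP v).
rewrite (dlim_emb (le_maxr _ _) _ ma) (dlim_emb (le_trans bc cm) _ ma).
congr dlim; rewrite !raddfD /=; congr (_ + _).
  rewrite (demb_comp _ _ (le_trans uc cm)) -(demb_comp uc cm) eu.
  exact: demb_comp.
rewrite (demb_comp _ _ (le_trans vc' cm')) -(demb_comp vc' cm') ev.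
exact: demb_comp.
Qed.

Lemma lim_oppE b (ba : (b < a)%O) x : lim_opp (dlim ba x) = dlim ba (- x).
Proof.
rewrite /lim_opp; set u := repr _.
have := reprK (dlim ba x); rewrite -/u -[\pi u]/(lim_class u) lim_classE.
move=> /dlim_eq[c [uc [bc [ca eu]]]].
by rewrite (dlim_emb uc _ ca) (dlim_emb bc _ ca) !raddfN eu.
Qed.

Lemma dlimP2 x y : exists b (ba : (b < a)%O) x' y', x = dlim ba x' /\ y = dlim ba y'.
Proof.
have [b [ba [x' ->]]] := dlimP x; have [c [ca [y' ->]]] := dlimP y.
have ma : (Order.max b c < a)%O by rewrite gt_max ba.
exists (Order.max b c), ma, (demb S (le_maxl _ _) x'), (demb S (le_maxr _ _) y').
by split; apply: dlim_emb.
Qed.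

Lemma lim_zeroE b (ba : (b < a)%O) : lim_zero = dlim ba 0.
Proof. by rewrite /lim_zero (dlim_emb (le0x b) _ ba) raddf0. Qed.

Lemma lim_addA : associative lim_add.
Proof.
move=> x y z; have [b [ba [x' [y' [-> ->]]]]] := dlimP2 x y.
have [c [ca [z' ->]]] := dlimP z.
have ma : (Order.max b c < a)%O by rewrite gt_max ba.
rewrite (dlim_emb (le_maxl b c) ba ma x') (dlim_emb (le_maxl b c) ba ma y').
by rewrite (dlim_emb (le_maxr b c) ca ma) !lim_addE addrA.
Qed.

Lemma lim_addC : commutative lim_add.
Proof.
move=> x y; have [b [ba [x' [y' [-> ->]]]]] := dlimP2 x y.
by rewrite !lim_addE addrC.
Qed.

Lemma lim_add0 : left_id lim_zero lim_add.
Proof.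
move=> x; have [b [ba [x' ->]]] := dlimP x.
by rewrite (lim_zeroE ba) lim_addE add0r.
Qed.

Lemma lim_addN : left_inverse lim_zero lim_opp lim_add.
Proof.
move=> x; have [b [ba [x' ->]]] := dlimP x.
by rewrite lim_oppE lim_addE addNr (lim_zeroE ba).
Qed.

HB.instance Definition _ :=
  GRing.isZmodule.Build (dirlim a0) lim_addA lim_addC lim_add0 lim_addN.

Lemma dlimD b (ba : (b < a)%O) x y : dlim ba (x + y) = dlim ba x + dlim ba y.
Proof. by rewrite -lim_addE. Qed.

End DirectLimit.

(* The recursion clauses determine the direct system up to a unique isomorphism.
   [iu_base] (resp. [iu_step a0]) identifies its term of index [\bot] (resp.
   [a > \bot]) with [G] (resp. with the ultrapower of the direct limit of the
   terms of index [< a]). Such systems exist: [iterated_ultrapower_exists]. *)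
Record iterated_ultrapower (p : omega_star) (G : zmodType)
    d (I : tbOrderType d) := IteratedUltrapower {
  iu_system :> dsystem I;
  iu_base : {additive G -> iu_system \bot%O};
  iu_base_bij : bijective iu_base;
  iu_step : forall (a : I) (a0 : (\bot < a)%O),
    {additive ult p (dirlim iu_system a0) -> iu_system a};
  iu_step_bij : forall a (a0 : (\bot < a)%O), bijective (iu_step a0);
  iu_emb : forall (a b : I) (ab : (a < b)%O) (b0 : (\bot < b)%O) (x : iu_system a),
    demb iu_system (ltW ab) x
      = iu_step b0 (ult_class p (fun=> dlim b0 ab x)) }.

Local Notation "{ 'quot' I }" := (Quotient.quot I) : type_scope.

Section Circle.
Variable R : realType.

Definition integer (t : R) : bool := t \is a Num.int.

Lemma integer_closed : zmod_closed integer.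
Proof. by split=> [|s t]; [exact: rpred0|exact: rpredB]. Qed.
HB.instance Definition _ := GRing.isZmodClosed.Build R integer integer_closed.
Definition integers : zmodClosed R := GRing.ZmodClosed.clone R integer _.

(* The circle group, as R / Z. *)
Definition circle : Type := quotient_topology {quot integers}.
HB.instance Definition _ := Topological.on circle.
HB.instance Definition _ := GRing.isZmodule.Build circle
  (@Quotient.addqA R integers) (@Quotient.addqC R integers)
  (@Quotient.add0q R integers) (@Quotient.addNq R integers).

Definition to_circle (t : R) : circle := \pi_{quot integers} t.

Lemma to_circle_eq s t : to_circle s = to_circle t <-> s - t \is a Num.int.
Proof.
rewrite -[_ \is a _]/(s - t \in integers) Quotient.idealrBE.
by split=> [e|/eqP//]; apply/eqP.
Qed.

Lemma to_circleD s t : to_circle (s + t) = to_circle s + to_circle t.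
Proof. exact: (@Quotient.pi_add R integers). Qed.

Lemma to_circleP (x : circle) : exists t, x = to_circle t.
Proof. by exists (repr x); rewrite /to_circle reprK. Qed.

Lemma to_circle0 : to_circle 0 = 0.
Proof. by apply: (addrI (to_circle 0)); rewrite -to_circleD !addr0. Qed.

Lemma to_circleN s : to_circle (- s) = - to_circle s.
Proof. by apply/eqP; rewrite -addr_eq0 -to_circleD addNr to_circle0. Qed.

Lemma to_circle_continuous : continuous to_circle.
Proof. exact: (@pi_continuous R {quot integers}). Qed.

Lemma to_circle_open (A : set R) : open A -> open (to_circle @` A).
Proof.
move=> oA; have -> : open (to_circle @` A)
    = open (\bigcup_(k in [set: int]) ((fun t => t + k%:~R) @^-1` A)).
  rewrite /open/= /quotient_open; congr open; apply/seteqP; split=> t /=.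
    move=> [s As /to_circle_eq/intrP[k e]]; exists k => //=.
    by rewrite -e addrC subrK.
  move=> [k _ /= At]; exists (t + k%:~R) => //; apply/to_circle_eq.
  by rewrite addrC addKr; apply/intrP; exists k.
apply: bigcup_open => k _; apply: open_comp => // t _.
exact: cvgD cvg_id (cvg_cst _).
Qed.

Lemma circle_compact : compact [set: circle].
Proof.
have -> : [set: circle] = to_circle @` `[0, 1].
  apply/seteqP; split=> // x _; have [t ->] := to_circleP x.
  exists (t - (Num.floor t)%:~R); last first.
    by apply/to_circle_eq; rewrite addrAC subrr add0r rpredN; apply: intr_int.
  rewrite /= in_itv /= subr_ge0 floor_le_tmp lerBlDl.
  by have := ltW (floorD1_gt t); rewrite intrD.
apply: continuous_compact; last exact: segment_compact.
exact: continuous_subspaceT to_circle_continuous.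
Qed.

Lemma circle_hausdorff : hausdorff_space circle.
Proof.
rewrite open_hausdorff => x y; have [s ->] := to_circleP x.
have [t ->] := to_circleP y => nst.
pose n := Num.floor (s - t).
have n1 : n%:~R < s - t.
  rewrite lt_neqAle floor_le_tmp andbT; apply: contra nst => /eqP e.
  by apply/eqP/to_circle_eq; rewrite -e; apply: intr_int.
have n2 : s - t < n%:~R + 1 by rewrite -[1]/(1%:~R) -intrD floorD1_gt.
pose e := Num.min (s - t - n%:~R) (n%:~R + 1 - (s - t)).
have e0 : 0 < e by rewrite lt_min !subr_gt0 n1.
exists (to_circle @` ball s (e / 2), to_circle @` ball t (e / 2)) => /=.
  by split; apply/mem_set; eexists; try reflexivity; apply: ballxx; rewrite divr_gt0.
split; try by apply: to_circle_open; apply: ball_open; rewrite divr_gt0.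
apply/eqP/seteqP; split=> // z [[s' sb <-] [t' tb /to_circle_eq/intrP[m tm]]].
move: sb tb; rewrite /ball /= !ltr_distl.
have : e <= s - t - n%:~R by rewrite ge_min lexx.
have : e <= n%:~R + 1 - (s - t) by rewrite ge_min lexx orbT.
move=> ea eb /andP[s1 s2] /andP[t1 t2].
have : (n < - m)%R by rewrite -(ltr_int R) rmorphN /= -tm; lra.
have : (- m < n + 1)%R by rewrite -(ltr_int R) rmorphN rmorphD /= -tm; lra.
by rewrite ltzD1 leNgt => /negbTE->.
Qed.

Lemma circle_add_continuous : continuous (fun x : circle * circle => x.1 + x.2).
Proof.
move=> -[x y]; have [s ->] := to_circleP x; have [t ->] := to_circleP y.
move=> A /=; rewrite -to_circleD => /to_circle_continuous.
move=> /(@add_continuous R (s, t)) [[U V] [/= Us Vt] UV].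
rewrite !nbhsE in Us Vt; case: Us => U' [oU' U's] U'U; case: Vt => V' [oV' V't] V'V.
exists (to_circle @` U', to_circle @` V').
  by split; apply: open_nbhs_nbhs; split;
    [exact: to_circle_open | by exists s | exact: to_circle_open | by exists t].
move=> [_ _] /= [[s' s'U <-] [t' t'V <-]]; rewrite -to_circleD.
by apply: (UV (s', t')); split; [exact: U'U|exact: V'V].
Qed.

End Circle.

Section Extension.
Variables (R : realType) (p : omega_star) (G : zmodType).
Variables (d : Order.disp_t) (I : tbOrderType d).
Hypothesis wfI : well_founded (fun a b : I => (a < b)%O).
Variable T : iterated_ultrapower p G I.

(* The second clause is [Phi [f] = p-lim_n Phi (f n)], the value of Phi at the
   element [f n] of the direct limit being computed on an arbitrary
   representative [s n] of it. *)
Record extends (Phi : {additive G -> circle R})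
    (Psi : forall a : I, {additive T a -> circle R}) : Prop := Extends {
  extends_base : forall g, Psi \bot%O (iu_base T g) = Phi g;
  extends_step : forall a (a0 : (\bot < a)%O) (s : nat -> below T a),
    Psi (tag (val (s n))) (tagged (val (s n))) @[n --> ultra p]
      --> Psi a (iu_step T a0 (ult_class p (fun n => lim_class a0 (s n)))) }.

Variable Phi : {additive G -> circle R}.

Inductive ext_rel : forall a : I, T a -> circle R -> Prop :=
| ext_rel_base g : ext_rel (iu_base T g) (Phi g)
| ext_rel_step a (a0 : (\bot < a)%O) (s : nat -> below T a) z l :
    (forall n, ext_rel (tagged (val (s n))) (z n)) -> z @ ultra p --> l ->
    ext_rel (iu_step T a0 (ult_class p (fun n => lim_class a0 (s n)))) l.

Lemma ext_rel_bot g l : ext_rel (iu_base T g) l -> l = Phi g.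
Proof.
move=> e; have : forall a (x : T a) l, ext_rel x l -> forall (ab : a = \bot%O),
    ecast a (T a) ab x = iu_base T g -> l = Phi g.
  move=> a x m [g' ab|b b0 s z m' _ _ ab]; last first.
    by have := b0; rewrite [in X in X -> _]ab ltxx.
  rewrite (Prop_irrelevance ab erefl) /= => /(bij_inj (iu_base_bij T)) ->//.
by move=> /(_ _ _ _ e erefl); apply.
Qed.

Lemma ext_rel_inv a (a0 : (\bot < a)%O) (x : T a) l : ext_rel x l ->
  exists s z, [/\ x = iu_step T a0 (ult_class p (fun n => lim_class a0 (s n))),
    forall n, ext_rel (tagged (val (s n))) (z n) & z @ ultra p --> l].
Proof.
move=> r; move: a0; case: r => [g|b b0 s z m rz zm] a0; first by have := a0; rewrite ltxx.
by exists s, z; split=> //; rewrite (bool_irrelevance a0 b0).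
Qed.

Lemma ext_rel_emb a b (ab : (a <= b)%O) x l :
  ext_rel x l -> ext_rel (demb T ab x) l.
Proof.
have [e|ab' rx] := eqVneq a b.
  by subst b; rewrite demb_id.
have lab : (a < b)%O by rewrite lt_neqAle ab'.
rewrite (bool_irrelevance ab (ltW lab)) (iu_emb lab (le_lt_trans (le0x a) lab)).
by apply: (@ext_rel_step _ _ _ (fun=> l) l) => [n|]; [by []|exact: cvg_cst].
Qed.

Lemma circle_lim_unique (z : nat -> circle R) (l m : circle R) :
  z @ ultra p --> l -> z @ ultra p --> m -> l = m.
Proof. exact: (@cvg_unique _ (@circle_hausdorff R)). Qed.

Lemma ext_rel_fun a (x : T a) l m : ext_rel x l -> ext_rel x m -> l = m.
Proof.
elim/(well_founded_ind wfI): a x l m => a IH x l m.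
have [e|a0] := eqVneq a \bot%O.
  subst a => rl rm; have [g xg] : exists g, x = iu_base T g.
    by have [h _ hK] := iu_base_bij T; exists (h x); rewrite hK.
  by subst x; rewrite (ext_rel_bot rl) (ext_rel_bot rm).
rewrite -lt0x in a0 => /(ext_rel_inv a0)[s [z [-> rz zl]]].
move=> /(ext_rel_inv a0)[t [w [/(bij_inj (iu_step_bij T a0))/eqP/ult_eqP st rw wm]]].
apply: circle_lim_unique zl _.
apply: cvg_trans wm; apply: near_eq_cvg; apply: filterS st => n /=.
rewrite !lim_classE => /dlim_eq[c [sc [tc [ca e]]]].
apply: esym; apply: (IH c ca (demb T sc (tagged (val (s n))))); first exact: ext_rel_emb.
by rewrite e; exact: ext_rel_emb.
Qed.

Lemma circle_lim_exists (z : nat -> circle R) : exists l : circle R, z @ ultra p --> l.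
Proof.
have zp : ProperFilter (z @ ultra p) by exact: fmap_proper_filter.
have uz : UltraFilter (z @ ultra p).
  split=> // F FF zF; apply/seteqP; split=> // A FA.
  have [//|nA] := in_ultra_setVsetC (z @^-1` A) (ultra_filter p).
  by have [t []] := filter_ex (filterI FA (zF (~` A) nA)).
have := @circle_compact R; rewrite compact_ultra => /(_ _ uz filterT).
by move=> [l [_ zl]]; exists l.
Qed.

Lemma ext_rel_total a (x : T a) : exists l, ext_rel x l.
Proof.
elim/(well_founded_ind wfI): a x => a IH x.
have [e|a0] := eqVneq a \bot%O.
  subst a; have [h _ hK] := iu_base_bij T.
  by exists (Phi (h x)); rewrite -{1}(hK x); exact: ext_rel_base.
rewrite -lt0x in a0; have [h _ hK] := iu_step_bij T a0.
have [f fE] := ult_classP (h x).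
have /choice[z rz] : forall n, exists l, ext_rel (tagged (val (repr (f n)))) l.
  by move=> n; apply: IH; exact: valP (repr (f n)).
have [l zl] := circle_lim_exists z; exists l.
rewrite -(hK x) fE (_ : f = fun n => lim_class a0 (repr (f n))).
  exact: ext_rel_step rz zl.
by apply/funext => n; rewrite /lim_class reprK.
Qed.

Lemma ext_relD a (x y : T a) l m :
  ext_rel x l -> ext_rel y m -> ext_rel (x + y) (l + m).
Proof.
elim/(well_founded_ind wfI): a x y l m => a IH x y l m.
have [e|a0] := eqVneq a \bot%O.
  subst a; have [h _ hK] := iu_base_bij T; rewrite -(hK x) -(hK y).
  move=> /ext_rel_bot -> /ext_rel_bot ->; rewrite -!raddfD; exact: ext_rel_base.
rewrite -lt0x in a0.
move=> /(ext_rel_inv a0)[s [z [-> rz zl]]] /(ext_rel_inv a0)[t [w [-> rw wm]]].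
rewrite -raddfD -ult_classD.
pose u n : below T a := exist (fun x : {b : I & T b} => (tag x < a)%O)
  (existT (fun b => T b) _ (demb T (le_maxl _ _) (tagged (val (s n)))
   + demb T (le_maxr _ _) (tagged (val (t n))))) (max_below (s n) (t n)).
rewrite (_ : (fun n => _) = fun n => lim_class a0 (u n)); last first.
  apply/funext => n; rewrite !lim_classE dlimD; congr (_ + _); exact: dlim_emb.
apply: (@ext_rel_step _ _ _ (fun n => z n + w n)) => [n|].
  by apply: IH; [exact: max_below|exact: ext_rel_emb|exact: ext_rel_emb].
apply: (continuous2_cvg _ (h := fun u v => u + v) _ zl wm).
exact: (@circle_add_continuous R (l, m)).
Qed.

Lemma extension_exists : exists Psi, extends Phi Psi.
Proof.
have /choice[f fP] : forall x : {a : I & T a}, exists l, ext_rel (tagged x) l.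
  by move=> x; exact: ext_rel_total.
pose psi a (x : T a) := f (existT (fun b => T b) a x).
have psiP a (x : T a) : ext_rel x (psi a x) by exact: fP (existT (fun b => T b) a x).
have psiB a : zmod_morphism (psi a).
  move=> x y; apply/eqP; rewrite eq_sym subr_eq; apply/eqP.
  apply: ext_rel_fun (psiP _ _) _.
  by rewrite -{1}(subrK y x); exact: ext_relD.
pose Psi a : {additive T a -> circle R} := HB.pack (psi a)
  (GRing.isZmodMorphism.Build _ _ (psi a) (psiB a)).
exists Psi; split=> [g|a a0 s]; first exact: ext_rel_bot (psiP _ _).
have [l zl] := circle_lim_exists (fun n => psi _ (tagged (val (s n)))).
rewrite (_ : Psi a _ = l) //; apply: ext_rel_fun (psiP _ _) _.
exact: ext_rel_step (fun n => psiP _ _) zl.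
Qed.

Lemma extension_unique Psi Psi' : extends Phi Psi -> extends Phi Psi' ->
  forall a, Psi a =1 Psi' a.
Proof.
move=> eP eP' a; elim/(well_founded_ind wfI): a => a IH x.
have [e|a0] := eqVneq a \bot%O.
  subst a; have [h _ hK] := iu_base_bij T; rewrite -(hK x).
  by rewrite (extends_base eP) (extends_base eP').
rewrite -lt0x in a0; have [h _ hK] := iu_step_bij T a0.
have [f fE] := ult_classP (h x); rewrite -(hK x) fE.
rewrite (_ : f = fun n => lim_class a0 (repr (f n))); last first.
  by apply/funext => n; rewrite /lim_class reprK.
have /circle_lim_unique := @extends_step _ _ eP _ a0 (fun n => repr (f n)); apply.
rewrite (_ : (fun n => _) = fun n => Psi' _ (tagged (val (repr (f n))))).
  exact: (@extends_step _ _ eP' _ a0 (fun n => repr (f n))).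
by apply/funext => n; apply: IH; exact: valP (repr (f n)).
Qed.

End Extension.

(* The well-order of the ordinals [<= omega_1], [\bot] being 0 and [\top] being
   omega_1. It exists: [omega1_closed_exists]. *)
Record omega1_closed := Omega1Closed {
  o1_disp : Order.disp_t;
  o1_order :> tbOrderType o1_disp;
  o1_wf : well_founded (fun a b : o1_order => (a < b)%O);
  o1_top : ~ countable [set a : o1_order | (a < \top)%O];
  o1_lt_top : forall a : o1_order, (a < \top)%O ->
    countable [set b : o1_order | (b < a)%O] }.

Section Bohr.
Variables (R : realType) (p : omega_star) (G : zmodType) (I : omega1_closed).
Variable T : iterated_ultrapower p G I.

Definition extension (Phi : {additive G -> circle R}) :
    forall a : I, {additive T a -> circle R} :=
  projT1 (cid (extension_exists (@o1_wf I) T Phi)).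

Lemma extensionP Phi : extends Phi (extension Phi).
Proof. exact: projT2 (cid _). Qed.

Definition ult_omega1 : Type := T \top%O.
HB.instance Definition _ := GRing.Zmodule.on ult_omega1.

Definition extension_top (Phi : {additive G -> circle R}) :
  ult_omega1 -> circle R := extension Phi \top%O.

(* The weakest topology making every [extension_top Phi] continuous. *)
Definition bohr : Type := sup_topology (fun Phi : {additive G -> circle R} =>
  Topological.on (initial_topology (extension_top Phi))).
HB.instance Definition _ := GRing.Zmodule.on bohr.
HB.instance Definition _ := Topological.on bohr.

Definition bohr_kernel (x : bohr) : bool :=
  `[< forall Phi, extension_top Phi x = 0 >].

Lemma bohr_kernel_closed : zmod_closed bohr_kernel.
Proof.
split=> [|x y /asboolP kx /asboolP ky]; apply/asboolP => Phi.
  exact: (raddf0 (extension Phi \top%O)).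
have := raddfB (extension Phi \top%O) (x : T \top%O) (y : T \top%O).
by rewrite [X in _ = X - _]kx [X in _ = _ - X]ky subr0.
Qed.
HB.instance Definition _ :=
  GRing.isZmodClosed.Build bohr bohr_kernel bohr_kernel_closed.
Definition bohr_ker : zmodClosed bohr := GRing.ZmodClosed.clone bohr bohr_kernel _.

Definition Ult : Type := quotient_topology {quot bohr_ker}.
HB.instance Definition _ := Topological.on Ult.
HB.instance Definition _ := GRing.isZmodule.Build Ult
  (@Quotient.addqA bohr bohr_ker) (@Quotient.addqC bohr bohr_ker)
  (@Quotient.add0q bohr bohr_ker) (@Quotient.addNq bohr bohr_ker).

End Bohr.

Definition boolean_group (H : zmodType) := forall x : H, - x = x.
Definition topological_group (X : PreTopologicalZmodule.type) :=
  continuous (fun x : X * X => x.1 + x.2) /\ continuous (-%R : X -> X).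
Definition p_compact (p : omega_star) (X : topologicalType) :=
  forall x : nat -> X, exists l : X, x @ ultra p --> l.
Definition no_nontrivial_convergent_sequence (X : topologicalType) :=
  forall (x : nat -> X) (l : X), x @ \oo --> l ->
    exists c : X, \forall n \near \oo, x n = c.

(* A model of the iterated ultrapowers. An element of index [b] is represented by
   a function on [I -> nat] that reads the coordinate [b] of its argument, then a
   smaller coordinate, and so on down to a constant of [G]; [null b] holds of the
   representatives of 0. *)
Module UltrapowerModel.
Section Existence.
Variables (p : omega_star) (G : zmodType) (d : Order.disp_t) (I : tbOrderType d).
Hypothesis wfI : well_founded (fun a b : I => (a < b)%O).

Local Notation fct := ((I -> nat) -> G).
Implicit Types (a b c : I) (F : fct) (s : nat -> fct) (e : nat -> I).

Definition branch b s : fct := fun x => s (x b) x.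

Inductive tree : I -> fct -> Prop :=
| tree_cst g : tree \bot%O (fun=> g)
| tree_branch b e s : (\bot < b)%O -> (forall n, (e n < b)%O) ->
    (forall n, tree (e n) (s n)) -> tree b (branch b s).

Inductive null : I -> fct -> Prop :=
| null_zero : null \bot%O (fun=> 0)
| null_branch b e s A : (\bot < b)%O -> (forall n, (e n < b)%O) ->
    (forall n, tree (e n) (s n)) ->
    ultra p A -> (forall n, A n -> null (e n) (s n)) -> null b (branch b s).

Lemma tree_bot F : tree \bot%O F -> exists g, F = fun=> g.
Proof.
move bE : \bot%O => b tF; case: tF bE => [g|{}b e s b0 _ _] bE; first by exists g.
by move: b0; rewrite -bE ltxx.
Qed.

Lemma tree_inv b F : (\bot < b)%O -> tree b F -> exists e s,
  [/\ forall n, (e n < b)%O, forall n, tree (e n) (s n) & F = branch b s].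
Proof.
by move=> b0 tF; case: tF b0 => [g|{}b e s _ *]; [rewrite ltxx|exists e, s].
Qed.

Lemma null_bot F : null \bot%O F -> F = fun=> 0.
Proof.
move bE : \bot%O => b nF; case: nF bE => [//|{}b e s A b0 _ _ _ _] bE.
by move: b0; rewrite -bE ltxx.
Qed.

Lemma null_inv b F : (\bot < b)%O -> null b F -> exists e s,
  [/\ forall n, (e n < b)%O, forall n, tree (e n) (s n), F = branch b s &
    exists2 A, ultra p A & forall n, A n -> null (e n) (s n)].
Proof.
move=> b0 tF; case: tF b0 => [|{}b e s A _ eb ts pA ns _]; first by rewrite ltxx.
by exists e, s; split=> //; exists A.
Qed.

Lemma tree_le a b F : (a <= b)%O -> tree a F -> tree b F.
Proof.
rewrite le_eqVlt => /predU1P[->//|ab] tF.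
by apply: (@tree_branch b (fun=> a) (fun=> F)) => //; exact: le_lt_trans (le0x a) ab.
Qed.

Lemma tree_null b F : null b F -> tree b F.
Proof.
case=> [|{}b e s A b0 eb ts _ _]; first exact: tree_cst.
exact: tree_branch b0 eb ts.
Qed.

Lemma null_le a b F : (a <= b)%O -> null a F -> null b F.
Proof.
rewrite le_eqVlt => /predU1P[->//|ab] nF.
apply: (@null_branch b (fun=> a) (fun=> F) setT) => //; last exact: filterT.
  exact: le_lt_trans (le0x a) ab.
by move=> _; exact: tree_null.
Qed.

Lemma bot_or b : b = \bot%O \/ (\bot < b)%O.
Proof. by rewrite lt0x; case: eqVneq => [->|]; [left|right]. Qed.

Lemma treeB b F F' : tree b F -> tree b F' -> tree b (F - F').
Proof.
elim/(well_founded_ind wfI): b F F' => b IH F F'; case: (bot_or b) => [->|b0].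
  by move=> /tree_bot[g ->] /tree_bot[g' ->]; exact: (tree_cst (g - g')).
move=> /(tree_inv b0)[e [s [eb ts ->]]] /(tree_inv b0)[e' [s' [eb' ts' ->]]].
apply: (@tree_branch b (fun n => Order.max (e n) (e' n)) (fun n => s n - s' n)) => // n.
  by rewrite gt_max eb eb'.
apply: IH; first by rewrite gt_max eb eb'.
  exact: tree_le (le_maxl _ _) (ts n).
exact: tree_le (le_maxr _ _) (ts' n).
Qed.

Lemma nullB b F F' : null b F -> null b F' -> null b (F - F').
Proof.
elim/(well_founded_ind wfI): b F F' => b IH F F'; case: (bot_or b) => [->|b0].
  move=> /null_bot-> /null_bot->; rewrite (_ : _ - _ = fun=> 0); first exact: null_zero.
  by apply/funext => x; exact: subrr.
move=> /(null_inv b0)[e [s [eb ts -> [A pA sA]]]].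
move=> /(null_inv b0)[e' [s' [eb' ts' -> [A' pA' sA']]]].
apply: (@null_branch b (fun n => Order.max (e n) (e' n)) (fun n => s n - s' n)
  (A `&` A')) => // [n|n||n [An A'n]].
- by rewrite gt_max eb eb'.
- by apply: treeB; [exact: tree_le (le_maxl _ _) _|exact: tree_le (le_maxr _ _) _].
- exact: filterI.
- apply: IH; first by rewrite gt_max eb eb'.
    exact: null_le (le_maxl _ _) (sA n An).
  exact: null_le (le_maxr _ _) (sA' n A'n).
Qed.

Lemma null0 b : null b 0.
Proof. exact: null_le (le0x b) null_zero. Qed.

Lemma tree0 b : tree b 0. Proof. exact/tree_null/null0. Qed.

Definition upd b (x : I -> nat) n : I -> nat := fun c => if c == b then n else x c.

Lemma tree_local a b F : tree a F -> (a < b)%O -> forall x n, F (upd b x n) = F x.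
Proof.
elim=> [//|{}a e s a0 ea _ IH] ab x n; have -> : branch a s (upd b x n) = s (x a) (upd b x n).
  by rewrite /branch /upd lt_eqF.
by apply: IH; exact: lt_trans (ea _) ab.
Qed.

Lemma branch_inj b e s e' s' :
  (forall n, (e n < b)%O) -> (forall n, tree (e n) (s n)) ->
  (forall n, (e' n < b)%O) -> (forall n, tree (e' n) (s' n)) ->
  branch b s = branch b s' -> s = s'.
Proof.
move=> eb ts eb' ts' ss; apply/funext => n; apply/funext => x.
have := congr1 (fun F => F (upd b x n)) ss.
have bn s'' : branch b s'' (upd b x n) = s'' n (upd b x n).
  by rewrite /branch {1}/upd eqxx.
by rewrite !bn (tree_local (ts n) (eb n)) (tree_local (ts' n) (eb' n)).
Qed.

Lemma null_down a b F : (a <= b)%O -> tree a F -> null b F -> null a F.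
Proof.
elim/(well_founded_ind wfI): b a F => b IH a F.
rewrite le_eqVlt => /predU1P[->//|ab] tF.
have b0 := le_lt_trans (le0x a) ab.
move=> /(null_inv b0)[e [s [eb ts FE [A pA sA]]]].
have [n An] := filter_ex pA.
have sF : s = fun=> F.
  by apply: (@branch_inj b e s (fun=> a) (fun=> F)) => //; rewrite -FE.
have nF : null (e n) F by have := sA n An; rewrite sF.
have mb : (Order.max a (e n) < b)%O by rewrite gt_max ab eb.
exact: IH mb _ _ (le_maxl _ _) tF (null_le (le_maxr _ _) nF).
Qed.

Definition treeb b : {pred fct} := fun F => `[< tree b F >].

Lemma treeb_closed b : zmod_closed (treeb b).
Proof.
split=> [|F F' /asboolP tF /asboolP tF']; apply/asboolP; first exact: tree0.
exact: treeB.
Qed.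
HB.instance Definition _ b :=
  GRing.isZmodClosed.Build fct (treeb b) (treeb_closed b).

Definition trees b : Type := {F : fct | treeb b F}.
HB.instance Definition _ b := SubChoice.on (trees b).
HB.instance Definition _ b := [SubChoice_isSubZmodule of trees b by <:].

Definition nullb b (F : trees b) : bool := `[< null b (val F) >].
Lemma nullb_closed b : zmod_closed (@nullb b).
Proof.
split=> [|F F' /asboolP tF /asboolP tF']; apply/asboolP; first exact: null0.
exact: nullB.
Qed.
HB.instance Definition _ b :=
  GRing.isZmodClosed.Build (trees b) (@nullb b) (@nullb_closed b).
Definition nulls b : zmodClosed (trees b) := GRing.ZmodClosed.clone _ (@nullb b) _.

Definition stage b : zmodType := {quot nulls b}.

Definition cls b F (tF : tree b F) : stage b :=
  \pi_{quot nulls b} (exist _ F (asboolT tF)).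
Definition rep b (x : stage b) : fct := val (repr x).

Lemma rep_tree b (x : stage b) : tree b (rep x).
Proof. exact: asboolW (valP (repr x)). Qed.

Lemma clsE b F F' (tF : tree b F) (tF' : tree b F') :
  cls tF = cls tF' <-> null b (F - F').
Proof.
split=> [/eqP|n].
  by rewrite /cls -Quotient.idealrBE => /asboolP.
by apply/eqP; rewrite /cls -Quotient.idealrBE; apply/asboolP.
Qed.

Lemma repK b (x : stage b) : cls (rep_tree x) = x.
Proof.
by rewrite -[RHS]reprK /cls; congr (\pi_ _ _); apply: val_inj.
Qed.

Lemma clsB b F F' (tF : tree b F) (tF' : tree b F') :
  cls (treeB tF tF') = cls tF - cls tF'.
Proof.
rewrite /cls -(pi_is_zmod_morphism {quot nulls b}).
by congr (\pi_ _ _); apply: val_inj.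
Qed.

Lemma rep_cls b F (tF : tree b F) : null b (rep (cls tF) - F).
Proof. by apply/(clsE (rep_tree _) tF); rewrite repK. Qed.

Definition emb a b (ab : (a <= b)%O) (x : stage a) : stage b :=
  cls (tree_le ab (rep_tree x)).

Lemma emb_cls a b (ab : (a <= b)%O) F (tF : tree a F) (tF' : tree b F) :
  emb ab (cls tF) = cls tF'.
Proof. by apply/clsE; apply: null_le ab _; exact: rep_cls. Qed.

Lemma emb_zmod a b (ab : (a <= b)%O) : zmod_morphism (emb ab).
Proof.
move=> x y; rewrite -[x]repK -[y]repK -clsB.
by rewrite !(emb_cls _ _ (tree_le ab (rep_tree _)))
  (emb_cls _ _ (treeB (tree_le ab (rep_tree _)) (tree_le ab (rep_tree _)))) clsB.
Qed.
HB.instance Definition _ a b (ab : (a <= b)%O) :=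
  GRing.isZmodMorphism.Build (stage a) (stage b) (emb ab) (emb_zmod ab).

Lemma emb_id a (aa : (a <= a)%O) x : emb aa x = x.
Proof. by rewrite -[in LHS](repK x) (emb_cls _ _ (rep_tree x)) repK. Qed.

Lemma emb_comp a b c (ab : (a <= b)%O) (bc : (b <= c)%O) (ac : (a <= c)%O) x :
  emb bc (emb ab x) = emb ac x.
Proof. by rewrite [emb ab x]/emb (emb_cls bc _ (tree_le ac (rep_tree x))). Qed.

Definition stages : dsystem I :=
  @DSystem d I stage (fun a b ab => emb ab : {additive _ -> _}) emb_id emb_comp.

Definition base (g : G) : stage \bot%O := cls (tree_cst g).

Lemma base_zmod : zmod_morphism base.
Proof. by move=> g g'; rewrite -clsB; apply/clsE; rewrite subrr; exact: null0. Qed.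
HB.instance Definition _ :=
  GRing.isZmodMorphism.Build G (stage \bot%O) base base_zmod.

Lemma base_bij : bijective base.
Proof.
rewrite -setTT_bijective; split=> // [g g' _ _|x _]; last first.
  have [g xg] := tree_bot (rep_tree x); exists g => //.
  by rewrite -[RHS]repK; apply/clsE; rewrite xg subrr; exact: null0.
move=> /clsE/null_bot/(congr1 (fun F => F (fun=> 0%N)))/eqP.
by rewrite /= subr_eq0 => /eqP.
Qed.

Section Step.
Variables (a : I) (a0 : (\bot < a)%O).

Definition rank (x : below stages a) : I := tag (val x).
Definition brep (x : below stages a) : fct := rep (tagged (val x)).

Lemma brep_tree x : tree (rank x) (brep x). Proof. exact: rep_tree. Qed.

Lemma bbranch_tree (u : nat -> below stages a) : tree a (branch a (brep \o u)).
Proof.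
apply: (@tree_branch _ (rank \o u)) => // n /=; last exact: brep_tree.
exact: (valP (u n)).
Qed.

Definition step_seq u : stage a := cls (bbranch_tree u).

Lemma lim_class_eq (x y : below stages a) : lim_class a0 x = lim_class a0 y <->
  exists2 c, (c < a)%O & null c (brep x - brep y).
Proof.
rewrite !lim_classE; split.
  move=> /dlim_eq[c [xc [yc [ca /clsE n]]]]; exists c => //.
move=> [c ca n].
pose m := Order.max c (Order.max (rank x) (rank y)).
have xm : (rank x <= m)%O by rewrite !le_max lexx orbT.
have ym : (rank y <= m)%O by rewrite !le_max lexx !orbT.
have ma : (m < a)%O by rewrite !gt_max ca (valP x) (valP y).
rewrite (dlim_emb a0 xm _ ma) (dlim_emb a0 ym _ ma); congr dlim.
by apply/clsE; apply: null_le n; rewrite le_max lexx.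
Qed.

Lemma branchB s s' : branch a s - branch a s' = branch a (fun n => s n - s' n).
Proof. by []. Qed.

Lemma null_branchP (b : nat -> I) s : (forall n, (b n < a)%O) ->
  (forall n, tree (b n) (s n)) ->
  null a (branch a s) <-> ultra p [set n | exists2 c, (c < a)%O & null c (s n)].
Proof.
move=> ba ts; split.
  move=> /(null_inv a0)[e [s' [ea ts' /(branch_inj ba ts ea ts') -> [A pA nA]]]].
  by apply: filterS pA => n An; exists (e n) => //; exact: nA.
move=> pA; apply: (null_branch a0 ba ts pA) => n [c ca nc].
apply: null_down (le_maxl (b n) c) (ts n) _.
exact: null_le (le_maxr _ _) nc.
Qed.

Lemma step_seq_eq u v : step_seq u = step_seq v <->
  ult_class p (lim_class a0 \o u) = ult_class p (lim_class a0 \o v).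
Proof.
rewrite /step_seq clsE branchB.
have uva n : (Order.max (rank (u n)) (rank (v n)) < a)%O by exact: max_below.
rewrite (null_branchP uva); last first.
  move=> n; apply: treeB.
    exact: tree_le (le_maxl _ _) (brep_tree (u n)).
  exact: tree_le (le_maxr _ _) (brep_tree (v n)).
rewrite (_ : [set n | _] = [set n | lim_class a0 (u n) = lim_class a0 (v n)]).
  by split=> [/ult_eqP/eqP|/eqP/ult_eqP].
by apply/seteqP; split=> n /= /lim_class_eq.
Qed.

Definition step (q : ult p (dirlim stages a0)) : stage a :=
  step_seq (fun n => repr (repr q n)).

Lemma lim_classK : cancel repr (lim_class a0 : below stages a -> _).
Proof. by move=> x; rewrite /lim_class reprK. Qed.

Lemma step_class (u : nat -> below stages a) :
  step (ult_class p (fun n => lim_class a0 (u n))) = step_seq u.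
Proof.
have [q qE] : exists q, q = ult_class p (fun n => lim_class a0 (u n)) by eexists.
rewrite -qE; apply/step_seq_eq; rewrite (_ : lim_class a0 \o _ = repr q).
  by rewrite /ult_class reprK -/(ult_class p _) qE.
by apply/funext => n /=; rewrite lim_classK.
Qed.

Lemma stepP (q : ult p (dirlim stages a0)) :
  exists u, q = ult_class p (fun n => lim_class a0 (u n)).
Proof.
exists (fun n => repr (repr q n)); rewrite -[LHS]reprK /ult_class; congr (\pi_ _ _).
by apply/funext => n; rewrite lim_classK.
Qed.

Lemma step_inj : injective step.
Proof.
move=> q q'; have [u ->] := stepP q; have [v ->] := stepP q'.
by rewrite !step_class => /step_seq_eq.
Qed.

Lemma step_surj x : exists q, step q = x.
Proof.
have [e [s [ea ts xs]]] := tree_inv a0 (rep_tree x).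
pose u n : below stages a := exist (fun x : {b : I & stages b} => (tag x < a)%O)
  (existT (fun b => stages b) (e n) (cls (ts n))) (ea n).
exists (ult_class p (fun n => lim_class a0 (u n))).
rewrite step_class -[RHS]repK; apply/clsE; rewrite xs branchB.
apply/(null_branchP ea) => [n|]; first by apply: treeB => //; exact: brep_tree (u n).
by apply: filterS filterT => n _; exists (e n) => //; exact: rep_cls.
Qed.

Lemma step_bij : bijective step.
Proof.
rewrite -setTT_bijective; split=> // [q q' _ _|x _]; first exact: step_inj.
by have [q <-] := step_surj x; exists q.
Qed.

Lemma dlimB b (ba : (b < a)%O) (x y : stages b) :
  dlim a0 ba (x - y) = dlim a0 ba x - dlim a0 ba y.
Proof. by apply/eqP; rewrite eq_sym subr_eq -dlimD subrK. Qed.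

Lemma repB b (x y : stage b) : null b (rep (x - y) - (rep x - rep y)).
Proof.
by apply/(clsE (rep_tree _) (treeB (rep_tree x) (rep_tree y))); rewrite clsB !repK.
Qed.

Lemma step_zmod : zmod_morphism step.
Proof.
move=> q q'.
have [f ->] := ult_classP q; have [g ->] := ult_classP q'.
have /choice[t tP] : forall n, exists t : {b : I & stages b * stages b}%type,
    exists ba : (tag t < a)%O, f n = dlim a0 ba (tagged t).1 /\
                              g n = dlim a0 ba (tagged t).2.
  move=> n; have [b [ba [x [y [-> ->]]]]] := dlimP2 (f n) (g n).
  by exists (existT (fun b => stages b * stages b)%type b (x, y)), ba.
pose ta n := projT1 (cid (tP n)).
pose mk (k : forall b, stages b * stages b -> stages b) n : below stages a :=
  exist (fun x : {b : I & stages b} => (tag x < a)%O)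
    (existT (fun b => stages b) (tag (t n)) (k _ (tagged (t n)))) (ta n).
pose u := mk (fun _ z => z.1); pose v := mk (fun _ z => z.2).
pose w := mk (fun _ z => z.1 - z.2).
have fE n : f n = lim_class a0 (u n) by have [] := projT2 (cid (tP n)).
have gE n : g n = lim_class a0 (v n) by have [] := projT2 (cid (tP n)).
have -> : ult_class p f - ult_class p g = ult_class p (fun n => lim_class a0 (w n)).
  apply/eqP; rewrite subr_eq -ult_classD; apply/eqP; congr ult_class.
  by apply/funext => n; rewrite fE gE -dlimD subrK.
rewrite (funext fE) (funext gE) !step_class -clsB; apply/clsE.
apply/(@null_branchP (fun n => tag (t n)) (fun n => brep (w n) - (brep (u n) - brep (v n)))).
- exact: ta.
- by move=> n; apply: treeB; [|apply: treeB]; exact: rep_tree.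
- by apply: filterS filterT => n _; exists (tag (t n)); [exact: ta|exact: repB].
Qed.
HB.instance Definition _ :=
  GRing.isZmodMorphism.Build (ult p (dirlim stages a0)) (stage a) step step_zmod.

End Step.

Lemma step_emb a b (ab : (a < b)%O) (b0 : (\bot < b)%O) (x : stages a) :
  demb stages (ltW ab) x = step (a0 := b0) (ult_class p (fun=> dlim b0 ab x)).
Proof.
by rewrite -[RHS]/(step (a0 := b0) (ult_class p (fun n => lim_class b0 _))) step_class; apply/clsE;
  rewrite subrr; exact: null0.
Qed.

Lemma model_exists : inhabited (iterated_ultrapower p G I).
Proof.
refine (inhabits (@IteratedUltrapower p G d I stages (base : {additive _ -> _}) base_bij
  (fun a h => @step a h : {additive _ -> _}) step_bij step_emb)).
Qed.

End Existence.
End UltrapowerModel.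

Lemma iterated_ultrapower_exists (p : omega_star) (G : zmodType)
    (I : omega1_closed) : inhabited (iterated_ultrapower p G I).
Proof. exact: (UltrapowerModel.model_exists p G (@o1_wf I)). Qed.

Module Omega1Model.
Section Model.
Variables (W : choiceType) (r : rel W) (m z : W).
Hypothesis r_wo : forall A : set W, A !=set0 -> exists2 x, A x & forall y, A y -> r x y.
Hypothesis r_anti : antisymmetric r.
Hypothesis r_min : forall x, r z x.

Lemma r_total : total r.
Proof.
move=> x y; have [|t [] -> ty] := r_wo (A := [set x; y]); first by exists x; left.
  by rewrite ty//; right.
by rewrite orbC ty//; left.
Qed.

Lemma r_refl : reflexive r.
Proof. by move=> x; have := r_total x x; rewrite orbb. Qed.

Lemma r_trans : transitive r.
Proof.
move=> y x t xy yt.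
have [|w [[]|] -> wm] := r_wo (A := [set x; y] `|` [set t]).
- by exists x; do 2 left.
- by apply: wm; right.
- by rewrite (@r_anti x y) // xy; apply: wm; do 2 left.
- by rewrite -(@r_anti y t) // yt; apply: wm; left; right.
Qed.

Definition seg : Type := {x : W | r x m}.
HB.instance Definition _ := Choice.on seg.
Definition seg_le (x y : seg) := r (val x) (val y).
Lemma seg_refl : reflexive seg_le. Proof. by move=> x; exact: r_refl. Qed.
Lemma seg_anti : antisymmetric seg_le.
Proof. by move=> x y /r_anti/val_inj. Qed.
Lemma seg_trans : transitive seg_le. Proof. by move=> y x t; exact: r_trans. Qed.
Lemma seg_total : total seg_le. Proof. by move=> x y; exact: r_total. Qed.
Fact seg_display : Order.disp_t. Proof. exact: (Order.Disp tt tt). Qed.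
HB.instance Definition _ := Order.Le_isPOrder.Build seg_display seg
  seg_refl seg_anti seg_trans.
HB.instance Definition _ := Order.POrder_isTotal.Build seg_display seg seg_total.
Definition seg0 : seg := exist _ z (r_min m).
Definition seg1 : seg := exist _ m (r_refl m).
Lemma seg0_le (x : seg) : (seg0 <= x)%O. Proof. exact: r_min. Qed.
Lemma seg1_le (x : seg) : (x <= seg1)%O. Proof. exact: (valP x). Qed.
HB.instance Definition _ := Order.hasBottom.Build seg_display seg seg0_le.
HB.instance Definition _ := Order.hasTop.Build seg_display seg seg1_le.
Definition seg_order : tbOrderType seg_display := seg.

Lemma seg_ltE (x y : seg_order) : (x < y)%O = (val x != val y) && r (val x) (val y).
Proof. by rewrite lt_neqAle -val_eqE. Qed.

Lemma seg_wf : well_founded (fun x y : seg_order => (x < y)%O).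
Proof.
move=> x; apply: contrapT => nx.
have [|w [y [yw ny]] wm] := r_wo (A := [set w | exists y : seg_order,
    val y = w /\ ~ Acc (fun x y : seg_order => (x < y)%O) y]).
  by exists (val x), x.
apply: ny; constructor => t; rewrite seg_ltE => /andP[/eqP ty rty].
apply: contrapT => nt; apply: ty; apply: r_anti; rewrite rty yw /=.
by apply: wm; exists t.
Qed.

Definition strict x : set W := [set w | w != x /\ r w x].
Hypothesis m_unc : ~ countable (strict m).
Hypothesis m_min : forall x, r x m -> x != m -> countable (strict x).

Lemma seg_image (x : seg_order) : val @` [set y : seg_order | (y < x)%O] = strict (val x).
Proof.
apply/seteqP; split=> [_ [y /= + <-]|w [wx rwx]] /=; first by rewrite seg_ltE => /andP.
have wm := r_trans rwx (valP x).
by exists (exist _ w wm) => //=; rewrite seg_ltE /= wx.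
Qed.

Lemma seg_countable (x : seg_order) :
  countable [set y : seg_order | (y < x)%O] <-> countable (strict (val x)).
Proof.
have vi : {in [set y : seg_order | (y < x)%O] &, injective val}.
  by move=> u v _ _; exact: val_inj.
by rewrite -seg_image (eq_countable (inj_card_eq vi)).
Qed.

Lemma model_exists : inhabited omega1_closed.
Proof.
refine (inhabits (@Omega1Closed seg_display seg_order seg_wf _ _)).
  by rewrite seg_countable.
move=> x; rewrite seg_ltE => /andP[xm rxm]; apply/seg_countable.
exact: m_min.
Qed.
End Model.

Lemma uncountable_cantor : ~ countable [set: nat -> bool].
Proof.
move=> /countable_injP[f finj].
pose g n := `[< forall u, f u = n -> ~~ u n >].
have [gT|/negP gF] := boolP (g (f g)).
  by have /asboolP/(_ g erefl) := gT; rewrite gT.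
apply: gF; apply/asboolP => u fu.
have -> : u = g by apply: finj => //; apply/mem_set.
by apply/negP => gT; have /asboolP/(_ g erefl) := gT; rewrite gT.
Qed.

Lemma omega1_closed_exists : inhabited omega1_closed.
Proof.
have [r0 wo0] := well_ordering_principle (nat -> bool).
have anti0 : antisymmetric r0.
  move=> x y /andP[xy yx].
  have refl0 t : r0 t t.
    have [|w [[+ wm] _]] := wo0 (pred1 t); first by exists t; rewrite inE.
    by move=> /eqP wt; rewrite -{1}wt; apply: wm; exact: eqxx.
  have [|w [_ wu]] := wo0 (pred2 x y); first by exists x; rewrite !inE eqxx.
  rewrite -(wu x) ?(wu y) //.
  - split; first by rewrite !inE eqxx orbT.
    by move=> t; rewrite !inE => /orP[]/eqP->.
  - split; first by rewrite !inE eqxx.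
    by move=> t; rewrite !inE => /orP[]/eqP->.
pose r (x y : option (nat -> bool)) :=
  if y is Some v then if x is Some u then r0 u v else false else true.
have r_anti : antisymmetric r.
  by move=> [u|] [v|] //= /anti0 ->.
have r_wo (A : set (option (nat -> bool))) :
    A !=set0 -> exists2 x, A x & forall y, A y -> r x y.
  move=> A0; have [[u Au]|nA] := pselect (exists u, A (Some u)).
    have [|w [[+ wm] _]] := wo0 (fun v => `[< A (Some v) >]).
      by exists u; apply/asboolP.
    move=> /asboolP Aw; exists (Some w) => // -[v|//] Av /=.
    by apply: wm; apply/asboolP.
  case: A0 => -[u Au|AN]; first by case: nA; exists u.
  by exists None => // -[v Av|//]; case: nA; exists v.
have [|z _ z_min] := r_wo setT; first by exists None.
have [|m m_unc mm] := r_wo [set x | ~ countable (strict r x)].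
  exists None => /= /countable_injP[f fi]; apply: uncountable_cantor.
  apply/countable_injP; exists (f \o Some) => u v _ _ /= fuv.
  by have [] : Some u = Some v by apply: fi => //; apply/mem_set.
apply: (@model_exists _ r m z) => // [x|x rxm xm]; first exact: z_min.
apply: contrapT => xu; move: xm; rewrite (r_anti x m) ?eqxx // rxm.
exact: mm.
Qed.
End Omega1Model.

Lemma omega1_closed_exists : inhabited omega1_closed.
Proof. exact: Omega1Model.omega1_closed_exists. Qed.

(* Main.v *)
Require Import Defs.
From HB Require Import structures.
From mathcomp Require Import all_boot all_order all_algebra finmap.
From mathcomp Require Import generic_quotient ring_quotient zify lra.
From mathcomp Require Import all_classical all_reals all_analysis.

(** Every element of an iterated ultrapower of G unfolds into a well-founded
    tree: an element of G is a leaf, and the class of a sequence is a node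
    whose n-th child unfolds the n-th term. A homomorphism chi from G to the
    two-element group takes a value on each tree by p-limits ([value]), and for
    Boolean G these values are exactly those of the extended characters
    ([representation_exists]). Conversely each tree is realized in some stage
    of index below omega_1, because omega_1 is regular
    ([realization_below_top]). So Ult is the set of trees, two of them being
    identified when all characters agree on them, with the topology of
    pointwise convergence on characters ([ult_cvg]). The Hausdorff and group
    properties are then inherited from the circle, and the p-limit of a
    sequence of trees is the node that has these trees as children.

    The absence of convergent sequences is a statement about trees
    ([no_null_sequence]). Suppose that every character vanishes on t_i for all
    but finitely many i, while for infinitely many i some character does not
    vanish on t_i. Then, given finitely many trees and a bound k, some
    character vanishes on these trees but not on some t_i with i >= k
    ([annihilator_frequent]). So a character can be changed, without changing
    its values on a finite set of trees, into one that is nonzero at a late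
    t_i. This is iterated along a set A in p: at stage n in A there are a
    finite set c of trees and a character chi; the n-th children of the members
    of c are added to c, as is an initial segment of an enumeration of the
    relevant trees, and chi is then changed off c so as to be nonzero at a late
    t_i, which is added to c too.

    For the limit character to have the same values on trees as the
    approximations, p-almost all children of a node must end up with the value
    of the node. For given c and chi, the n such that chi agrees at every u in
    c and at its n-th child form a set in p, by definition of the value. As p
    is selective, A can be chosen in p with each n in A belonging to the set of
    the stage that it meets ([selective_play]). By induction on trees the limit
    character takes the eventual values of the approximations, so it is nonzero
    on infinitely many t_i, a contradiction. *)

Set Implicit Arguments.
Unset Strict Implicit.
Unset Printing Implicit Defensive.
Import Order.TTheory GRing.Theory Num.Theory numFieldNormedType.Exports.
Local Open Scope classical_set_scope.
Local Open Scope ring_scope.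
Local Open Scope quotient_scope.

(** * Selective ultrafilters *)

Section SelectiveUltrafilter.
Variable p : omega_star.

Lemma ultraN A : ~ ultra p A -> ultra p (~` A).
Proof. by have [|] := in_ultra_setVsetC A (ultra_filter p). Qed.

Lemma ultra_geq n : ultra p [set m | (n <= m)%N].
Proof.
elim: n => [|n IH]; first by apply: filterS filterT => m.
apply: filterS2 IH (ultraN (@ultra_nonprincipal p n)) => m /= nm mn.
by rewrite ltn_neqAle nm andbT eq_sym; apply/eqP.
Qed.

Lemma ultra_unbounded A n : ultra p A -> exists2 m, A m & (n <= m)%N.
Proof. by move=> pA; have [m [Am nm]] := filter_ex (filterI pA (ultra_geq n)); exists m. Qed.

(** The P-point property is applied to the function mapping n to the first m with
    n outside U_m. It cannot be constant on a set of p, since each U_m is in p and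
    p is nonprincipal; being finite-to-one on a set A of p, it bounds A outside each U_m. Outputting
    n itself when all earlier U_m contain n makes the function total. *)
Lemma p_point_pseudo_intersection (U : nat -> set nat) : p_point p ->
  (forall m, ultra p (U m)) ->
  exists2 A, ultra p A & exists g : nat -> nat,
    forall m n, A n -> (g m <= n)%N -> U m n.
Proof.
move=> pp pU; pose out n m := `[< ~ U m n >] || (n <= m)%N.
have outn n : exists m, out n m by exists n; rewrite /out leqnn orbT.
pose f n := ex_minn (outn n).
have [A pA [fA|cA]] := pp f; last first.
  have [k Ak] := filter_ex pA.
  have pV : ultra p (U (f k) `&` [set n | ((f k).+1 <= n)%N]).
    exact: filterI (pU _) (ultra_geq _).
  have [n [An [Un kn]]] := filter_ex (filterI pA pV).
  have := cA _ _ An Ak; rewrite {1}/f; case: ex_minnP => m + _ mk.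
  rewrite /out mk => /orP[/asboolP//|]; by rewrite leqNgt kn.
exists A => //.
have gP m : exists g, forall n, A n -> (g <= n)%N -> U m n.
  have : finite_set (\bigcup_(k in `I_m.+1) (A `&` f @^-1` [set k])).
    by apply: bigcup_finite => // k _; exact: fA.
  move=> /finite_seqP[s sE]; exists (\max_(i <- s) i).+1 => n An; apply: contraPP => nU.
  have ns : n \in s.
    suff : [set` s] n by [].
    rewrite -sE; exists (f n) => //=; rewrite /f; case: ex_minnP => k _ km.
    by rewrite ltnS; apply: km; rewrite /out; apply/orP; left; apply/asboolP.
  by apply/negP; rewrite -leqNgt; exact: (@leq_bigmax_seq _ _ xpredT id).
by have [g gg] := choice gP; exists g.
Qed.

(** Cut omega into intervals [k_i, k_(i+1)[ with G(k_i) <= k_(i+1). The Q-point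
    property gives a set of p with at most one point in each interval, and
    keeping the intervals of one parity leaves a whole interval between any two
    points m < n of the set, so that n is beyond G(m). *)
Lemma q_point_sparse (G : nat -> nat) : q_point p -> {homo G : m n / (m <= n)%N} ->
  exists2 A, ultra p A & forall m n, A m -> A n -> (m < n)%N -> (G m <= n)%N.
Proof.
move=> qp Gm.
pose k i := iter i (fun m => maxn m.+1 (G m)) 0%N.
have kS i : (k i < k i.+1)%N by rewrite /= leq_max ltnSn.
have GkS i : (G (k i) <= k i.+1)%N by rewrite /= leq_max leqnn orbT.
have kh : {homo k : i j / (i <= j)%N} by apply: homo_leq => // [|i]; [exact: leq_trans|exact/ltnW].
have ki i : (i <= k i)%N by elim: i => // i IH; exact: leq_ltn_trans IH (kS i).
have hP n : exists i, (n < k i.+1)%N by exists n; exact: ki.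
pose h n := ex_minn (hP n).
have hlt n : (n < k (h n).+1)%N by rewrite /h; case: ex_minnP.
have hle n : (k (h n) <= n)%N.
  rewrite /h; case: ex_minnP => -[//|i] _ im; rewrite leqNgt; apply/negP => /im.
  by rewrite ltnn.
have hh : {homo h : m n / (m <= n)%N}.
  move=> m n mn; rewrite leqNgt; apply/negP => nm.
  have := leq_ltn_trans mn (hlt n); rewrite ltnNge => /negP; apply.
  exact: leq_trans (kh _ _ nm) (hle m).
have [|A pA hA] := qp h.
  move=> i; apply: sub_finite_set (finite_II (k i.+1)) => n [_ /= <-]; exact: hlt.
suff [b pb] : exists b, ultra p [set n | odd (h n) = b].
  exists (A `&` [set n | odd (h n) = b]); first exact: filterI.
  move=> m n [Am mb] [An nb] mn.
  have hmn : ((h m).+1 < h n)%N.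
    have h1 : (h m < h n)%N.
      rewrite ltn_neqAle (hh _ _ (ltnW mn)) andbT; apply: contraTneq mn => e.
      by rewrite (hA m n) ?inE// ltnn.
    rewrite ltn_neqAle h1 andbT; apply/eqP => e.
    by move: mb nb; rewrite /= -e /= => ->; case: (b).
  apply: leq_trans (Gm _ _ (ltnW (hlt m))) _.
  exact: leq_trans (GkS _) (leq_trans (kh _ _ hmn) (hle n)).
have [pb|/ultraN pb] := pselect (ultra p [set n | odd (h n) = true]); first by exists true.
by exists false; apply: filterS pb => n /= /eqP; rewrite eqb_id => /negbTE.
Qed.

(** The P-point property gives g such that the points of A beyond g(m) are in U_m,
    and the Q-point property makes A so sparse that g(m) is at most every
    point of A after m. *)
Lemma selective_diagonal (U : nat -> set nat) : selective p ->
  (forall m, ultra p (U m)) ->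
  exists2 A, ultra p A & forall m n, A m -> A n -> (m < n)%N -> U m n.
Proof.
move=> [pp qp] pU; have [A pA [g gU]] := p_point_pseudo_intersection pp pU.
(* The sum bounds g and is monotone. *)
have [|B pB BG] := @q_point_sparse (fun m => \sum_(i < m.+1) g i)%N qp.
  move=> m n mn; rewrite -!(big_mkord xpredT) [leqRHS](@big_cat_nat _ _ _ m.+1) //.
  exact: leq_addr.
exists (A `&` B); first exact: filterI.
move=> m n [_ Bm] [An Bn] mn; apply: gU => //.
apply: leq_trans (BG _ _ Bm Bn mn).
by rewrite big_ord_recr /= leq_addl.
Qed.

(** The states that a play may have at time m, whichever of the moves below m were
    made. As there are finitely many of them, a single set of p consists of moves
    that are allowed in all of them. *)
Fixpoint reachable (S : Type) (s0 : S) (step : S -> nat -> S) m : set S :=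
  if m is k.+1 then reachable s0 step k `|` ((step^~ k) @` reachable s0 step k)
  else [set s0].

(** A play on p: a move n changes the state, and N gives the moves that are
    allowed in a state. The state at time n is the one left by the last move m < n,
    which is among the finitely many states reachable at time m + 1.
    Hence the diagonalization of the sets of n allowed in all of these states
    gives a set of p all of whose elements are allowed when they are played. *)
Lemma selective_play (S : Type) (s0 : S) (step : S -> nat -> S)
    (N : S -> set nat) : selective p -> (forall s, ultra p (N s)) ->
  exists A st, [/\ ultra p A, st 0%N = s0,
    forall n, A n -> st n.+1 = step (st n) n,
    forall n, ~ A n -> st n.+1 = st n &
    forall n, A n -> N (st n) n].
Proof.
move=> sel pN.
pose reach := reachable s0 step.
have pU m : ultra p [set n | forall s, reach m s -> N s n].
  elim: m N pN => [|m IH] N pN.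
    by apply: filterS (pN s0) => n Nn s ->.
  have /IH : forall s, ultra p (N s `&` N (step s m)) by move=> s; exact: filterI.
  by apply: filterS => n Nn s [/Nn[]//|[r /Nn[_ ?] <-]].
have [A pA AU] := selective_diagonal sel (fun m => pU m.+1).
pose B := A `&` [set n | forall s, reach 0%N s -> N s n].
pose fix st n := if n is m.+1 then
  if `[< B m >] then step (st m) m else st m else s0.
have stS n : B n -> st n.+1 = step (st n) n by move=> /asboolT /= ->.
have stN n : ~ B n -> st n.+1 = st n by move=> /asboolF /= ->.
have st_reach n : reach n (st n).
  elim: n => //= n IH; case: ifP => _; last by left.
  by right; exists (st n).
exists B, st; split=> //; first exact: filterI.
move=> n Bn; have [e|[m [mn Bm ->]]] : st n = s0 \/
    exists m, [/\ (m < n)%N, B m & st n = st m.+1].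
- elim: n {Bn} => [|n IH]; first by left.
  have [Bn|nBn] := pselect (B n); first by right; exists n.
  rewrite stN //; case: IH => [|[m [mn Bm ->]]]; [by left|right].
  by exists m; rewrite ltnS ltnW.
- by rewrite e; apply: Bn.2.
- by apply: (AU m n Bm.1 Bn.1 mn); exact: (st_reach m.+1).
Qed.

End SelectiveUltrafilter.

(** * Trees and their values *)

Inductive ptree (G : Type) := Leaf of G | Node of (nat -> ptree G).
HB.instance Definition _ (G : Type) := gen_eqMixin (ptree G).
HB.instance Definition _ (G : Type) := gen_choiceMixin (ptree G).

(** A leaf is its own child, which makes [value_child] hold for all trees. *)
Definition child G (u : ptree G) n := if u is Node s then s n else u.

Fixpoint descend G (u : ptree G) (w : seq nat) :=
  if w is n :: w' then descend (child u n) w' else u.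

Lemma descend_rcons G (u : ptree G) w n :
  descend u (rcons w n) = child (descend u w) n.
Proof. by elim: w u => //= m w IH u. Qed.

Section PTreeValue.
Variables (p : omega_star) (G : zmodType).
Implicit Types (chi psi : G -> bool) (u : ptree G).

Fixpoint value chi u : bool := match u with
  | Leaf g => chi g
  | Node s => `[< ultra p [set n | value chi (s n)] >]
  end.

Definition character chi := forall g h, chi (g + h) = chi g (+) chi h.

Lemma value_child chi u : ultra p [set n | value chi (child u n) = value chi u].
Proof.
case: u => [g|s] /=; first by apply: filterS filterT.
case: asboolP => [|/ultraN]; apply: filterS => n //=.
by move/negP/negbTE.
Qed.

Lemma value_node chi s b :
  ultra p [set n | value chi (s n) = b] -> value chi (Node s) = b.
Proof.
by move=> /(filterI (value_child chi (Node s)))/filter_ex[n [/= <- <-]].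
Qed.

(** p-limits of two-valued sequences commute with addition. *)
Lemma value_xor chi psi u :
  value (fun g => chi g (+) psi g) u = value chi u (+) value psi u.
Proof.
elim: u => // s IH; apply: value_node.
apply: filterS2 (value_child chi (Node s)) (value_child psi (Node s)) => n /=.
by rewrite IH => -> ->.
Qed.

Lemma character_xor chi psi : character chi -> character psi ->
  character (fun g => chi g (+) psi g).
Proof. by move=> hc hp g h; rewrite hc hp addbACA. Qed.

End PTreeValue.

(** * Null sequences of trees *)

Section NullSequence.
Variables (p : omega_star) (G : zmodType).
Variable r : nat -> G.
Hypothesis r_surj : forall g, exists m, r m = g.
Variable t : nat -> ptree G.
Hypothesis t_null : forall chi, character chi ->
  \forall i \near \oo, value p chi (t i) = false.
Hypothesis t_frequent : forall k, exists i chi,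
  [/\ (k <= i)%N, character chi & value p chi (t i)].
Implicit Types (c : seq (ptree G)) (chi psi : G -> bool).

(** Induction on c. Let psi be a character that vanishes on c but not on t_i for
    some late i. If psi is nonzero at the new tree u, it is corrected by adding
    a character psi0 that also vanishes on c and is nonzero at u, if there is one:
    psi0 vanishes on all late t_i, so the sum is still nonzero at t_i. If there
    is none, psi vanishes at u. *)
Lemma annihilator_frequent c k : exists i psi, [/\ (k <= i)%N, character psi,
  {in c, forall u, value p psi u = false} & value p psi (t i)].
Proof.
elim: c k => [|u c IH] k.
  by have [i [psi [ki hp ti]]] := t_frequent k; exists i, psi.
have [[psi0 [h0 c0 u0]]|no] := pselect (exists psi0, [/\ character psi0,
    {in c, forall u, value p psi0 u = false} & value p psi0 u]); last first.
  have [i [psi [ki hp cp ti]]] := IH k; exists i, psi; split=> // v.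
  rewrite inE => /predU1P[->|/cp//].
  by apply/negbTE/negP => pu; apply: no; exists psi.
have [k0 _ k0P] := t_null h0.
have [i [psi [ki hp cp ti]]] := IH (maxn k k0).
move: ki; rewrite geq_max => /andP[ki k0i].
have [pu|/negbTE pu] := boolP (value p psi u); last first.
  by exists i, psi; split=> // v; rewrite inE => /predU1P[->|/cp//].
exists i, (fun g => psi g (+) psi0 g); split=> //; first exact: character_xor.
  move=> v; rewrite value_xor inE => /predU1P[->|vc]; first by rewrite pu u0.
  by rewrite cp ?c0.
by rewrite value_xor ti (k0P i k0i).
Qed.

Lemma character_perturbation c chi k : character chi -> exists i chi',
  [/\ (k <= i)%N, character chi', {in c, value p chi' =1 value p chi} &
      value p chi' (t i)].
Proof.
move=> hc; have [k0 _ k0P] := t_null hc.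
have [i [psi [ki hp cp ti]]] := annihilator_frequent c (maxn k k0).
move: ki; rewrite geq_max => /andP[ki k0i].
exists i, (fun g => chi g (+) psi g); split=> //; first exact: character_xor.
  by move=> v vc; rewrite value_xor cp ?addbF.
by rewrite value_xor ti (k0P i k0i).
Qed.

(** An enumeration of all leaves and of all subtrees of the trees t_i, a countable
    family that is closed under children. *)
Definition subtree (j : nat) : ptree G :=
  match choice.unpickle j : option (nat + nat * seq nat) with
  | Some (inl m) => Leaf (r m)
  | Some (inr (i, w)) => descend (t i) w
  | None => Leaf 0
  end.

Lemma subtree_leaf g : exists j, subtree j = Leaf g.
Proof.
have [m <-] := r_surj g.
by exists (choice.pickle (inl m : nat + nat * seq nat)); rewrite /subtree choice.pickleK.
Qed.

Lemma subtree_root i : exists j, subtree j = t i.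
Proof. by exists (choice.pickle (inr (i, [::]) : nat + nat * seq nat)); rewrite /subtree choice.pickleK. Qed.

Lemma subtree_child j n : exists j', subtree j' = child (subtree j) n.
Proof.
have leaf g : child (Leaf g) n = Leaf g by [].
rewrite /subtree; case: (choice.unpickle j) => [[m|[i w]]|]; rewrite ?leaf; try by apply: subtree_leaf.
exists (choice.pickle (inr (i, rcons w n) : nat + nat * seq nat)).
by rewrite choice.pickleK descend_rcons.
Qed.

(** The trees whose value is settled, and the character that settles it. *)
Definition approximation : Type := seq (ptree G) * (G -> bool).

Definition grow c n :=
  c ++ [seq child u n | u <- c] ++ [seq subtree j | j <- iota 0 n.+1].

(** That s carries a character stands under the existential so that choice yields a
    total function on approximations, as [selective_play] requires. *)
Lemma advance_exists (s : approximation) n : exists s' : approximation, character s.2 ->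
  [/\ character s'.2, {subset grow s.1 n <= s'.1},
      {in grow s.1 n, value p s'.2 =1 value p s.2} &
      exists2 i, (n <= i)%N & t i \in s'.1 /\ value p s'.2 (t i)].
Proof.
have [hs|ns] := pselect (character s.2); last by exists s.
have [i [chi [ni hc cs ti]]] := character_perturbation (grow s.1 n) n hs.
exists (t i :: grow s.1 n, chi) => _; split=> //=.
  by move=> u ?; rewrite inE orbC; apply/orP; left.
by exists i => //; rewrite inE eqxx.
Qed.

Definition good_moves (s : approximation) : set nat :=
  [set n | {in s.1, forall u, value p s.2 (child u n) = value p s.2 u}].

Lemma good_moves_ultra s : ultra p (good_moves s).
Proof.
case: s => c chi; rewrite /good_moves /=; elim: c => [|u c IH].
  by apply: filterS filterT.
apply: filterS2 (value_child p chi u) IH => n un cn v.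
by rewrite inE => /predU1P[->|/cn].
Qed.

(** The approximations along the set A of [selective_play] settle the value of
    every tree of the enumeration. By induction on trees, the limit character has
    these settled values: for p-almost all n, the n-th child of a settled node
    was settled by a move n allowed at that stage, hence with the value of the
    node. *)
Lemma no_null_sequence : selective p -> False.
Proof.
move=> sel; have [adv advP] := choice (fun x : approximation * nat => advance_exists x.1 x.2).
have [A [st [pA st0 stA stN stG]]] := selective_play ([::], fun=> false)
  (fun s n => adv (s, n)) sel good_moves_ultra.
have hst n : character (st n).2.
  elim: n => [|n IH]; first by rewrite st0 => g h.
  have [An|nA] := pselect (A n); last by rewrite stN.
  by rewrite stA //; have [] := advP (st n, n) IH.
have advst n : A n -> [/\ {subset grow (st n).1 n <= (st n.+1).1},
    {in grow (st n).1 n, value p (st n.+1).2 =1 value p (st n).2} &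
    exists2 i, (n <= i)%N & t i \in (st n.+1).1 /\ value p (st n.+1).2 (t i)].
  by move=> An; rewrite stA //; have [] := advP (st n, n) (hst n).
have stS n : {subset (st n).1 <= (st n.+1).1} /\
    {in (st n).1, value p (st n.+1).2 =1 value p (st n).2}.
  have [An|nA] := pselect (A n); last by rewrite stN //; split.
  have [sub eqv _] := advst n An.
  have subg : {subset (st n).1 <= grow (st n).1 n}.
    by move=> u uc; rewrite mem_cat uc.
  by split=> u /subg; [exact: sub|exact: eqv].
have stD n k : {subset (st n).1 <= (st (n + k)%N).1} /\
    {in (st n).1, value p (st (n + k)%N).2 =1 value p (st n).2}.
  elim: k => [|k [IHs IHv]]; first by rewrite addn0; split.
  rewrite addnS; have [sub eqv] := stS (n + k)%N; split=> u uc.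
    exact/sub/IHs.
  by rewrite eqv ?IHv //; exact: IHs.
(* Eventual values, at first only meaningful on settled trees. *)
pose lim_value u := `[< \forall n \near \oo, value p (st n).2 u >].
have limE n u : u \in (st n).1 -> value p (st n).2 u = lim_value u.
  move=> un; apply/idP/asboolP => [vu|[k _ /(_ (k + n)%N)]].
    by exists n => // m /= /subnKC <-; rewrite (stD n _).2.
  by rewrite /= leq_addr addnC (stD n _).2 //; apply.
have memE j : exists n, subtree j \in (st n).1.
  have [n An jn] := ultra_unbounded j pA.
  exists n.+1; have [sub _ _] := advst n An; apply: sub.
  rewrite !mem_cat; apply/orP; right; apply/orP; right.
  by apply: map_f; rewrite mem_iota ltnS.
pose chi g := lim_value (Leaf g).
have chiE j : value p chi (subtree j) = lim_value (subtree j).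
  move uE : (subtree j) => u; elim: u j uE => [//|s IH] j uE.
  apply: value_node; have [k] := memE j; rewrite uE => kin.
  apply: filterS2 pA (ultra_geq p k) => n An /= /subnKC kn.
  have [j' j'E] := subtree_child j n; rewrite uE /= in j'E.
  have nin : Node s \in (st n).1 by rewrite -kn; exact: (stD k _).1.
  have [sub eqv _] := advst n An.
  have cin : s n \in grow (st n).1 n.
    rewrite !mem_cat; apply/orP; right; apply/orP; left.
    exact: (map_f (fun u => child u n) nin).
  rewrite (IH n j' j'E) -(limE n.+1) ?eqv//; last exact: sub.
  by rewrite -(limE n _ nin); exact: (stG n An _ nin).
have hchi : character chi.
  move=> g h.
  have late g' : exists k, forall n, (k <= n)%N -> chi g' = (st n).2 g'.
    have [j jE] := subtree_leaf g'; have [k] := memE j; rewrite jE => kin.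
    exists k => n /subnKC <-; rewrite /chi -(limE (k + (n - k))%N) //.
    exact: (stD k _).1.
  have [a aP] := late g; have [b bP] := late h; have [c cP] := late (g + h).
  pose m := maxn a (maxn b c).
  rewrite (aP m) ?(bP m) ?(cP m) ?hst // /m; lia.
have [k _ kP] := t_null hchi.
have [n An kn] := ultra_unbounded k pA.
have [_ _ [i ni [tin tiv]]] := advst n An.
have [j jE] := subtree_root i.
have := kP i (leq_trans kn ni).
by rewrite -jE chiE jE -(limE n.+1) // tiv.
Qed.

End NullSequence.

(** * The 2-torsion of the circle *)

Section CircleTorsion.
Variable R : realType.

Definition half_turn (b : bool) : circle R := to_circle (if b then 2^-1 else 0).

Lemma half_turn_false : half_turn false = 0.
Proof. exact: to_circle0. Qed.

Lemma half_turn_true_neq0 : half_turn true != 0.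
Proof.
apply/eqP; rewrite -half_turn_false => /to_circle_eq/intrP[m]; rewrite subr0 => e.
have : (0 < m)%R by rewrite -(ltr_int R) -e invr_gt0.
have : (m < 1)%R by rewrite -(ltr_int R) -e invf_lt1 // ltr1n.
lia.
Qed.

Lemma half_turn_inj : injective half_turn.
Proof.
by case=> [] [] // e; have := half_turn_true_neq0; rewrite -half_turn_false e eqxx.
Qed.

Lemma half_turnD b c : half_turn (b (+) c) = half_turn b + half_turn c.
Proof.
rewrite /half_turn -to_circleD; apply/to_circle_eq.
case: b c => [] [] /=; rewrite ?addr0 ?add0r ?subrr ?rpredN ?rpred0 //.
by rewrite (_ : _ + _ = 1) ?rpred1 //; lra.
Qed.

Lemma circle_2torsion (x : circle R) : x + x = 0 -> x = half_turn (x != 0).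
Proof.
have [->|] := eqVneq x 0; rewrite ?half_turn_false //=.
have [t ->] := to_circleP x; rewrite -to_circleD -to_circle0.
move=> /eqP nt /to_circle_eq/intrP[m]; rewrite subr0 => e.
have [k [mk|mk]] : exists k : int, m = 2 * k \/ m = 2 * k + 1.
- by exists (m %/ 2)%Z; lia.
- case: nt; apply/to_circle_eq/intrP; exists k.
  by move: e; rewrite mk rmorphM /=; lra.
- apply/to_circle_eq/intrP; exists k.
  by move: e; rewrite mk rmorphD rmorphM /=; lra.
Qed.

(** Pointwise convergence of two-valued sequences is eventual equality: the
    2-torsion of the Hausdorff circle is discrete. *)
Lemma half_turn_cvg (T : Type) (F : set_system T) {FF : ProperFilter F}
    (b : T -> bool) (c : bool) :
  (half_turn \o b) @ F --> half_turn c <-> \forall i \near F, b i = c.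
Proof.
split=> [bc|bc].
  have oc : open (~` [set half_turn (~~ c)]).
    apply: closed_openC; apply: accessible_closed_set1.
    by apply: hausdorff_accessible; exact: circle_hausdorff.
  have /bc : nbhs (half_turn c) (~` [set half_turn (~~ c)]).
    by apply: open_nbhs_nbhs; split=> // /half_turn_inj; case: (c).
  by apply: (@filterS _ F) => i /=; case: (b i); case: (c) => // h; case: h.
apply: cvg_trans (@cvg_cst _ (half_turn c) T F _); apply: near_eq_cvg.
by apply: filterS bc => i /= ->.
Qed.

End CircleTorsion.

(** * Trees represent the elements of the iterated ultrapowers *)

Section Characters.
Variables (R : realType) (p : omega_star) (G : zmodType) (I : omega1_closed).
Hypothesis G_boolean : forall g : G, g + g = 0.
Variable T : iterated_ultrapower p G I.
Implicit Types Phi : {additive G -> circle R}.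

(** As G is Boolean, a character to the circle takes only the values 0 and 1/2
    ([binaryE]), and is determined by where it is nonzero. *)
Definition binary Phi (g : G) := Phi g != 0.

Lemma binaryE Phi g : Phi g = half_turn R (binary Phi g).
Proof. by apply: circle_2torsion; rewrite -raddfD G_boolean raddf0. Qed.

Lemma binary_character Phi : character (binary Phi).
Proof.
by move=> g h; apply: (@half_turn_inj R); rewrite half_turnD -!binaryE raddfD.
Qed.

Lemma character_lift chi : character chi -> exists Phi, binary Phi =1 chi.
Proof.
move=> hc; pose f g := half_turn R (chi g).
have chi0 : chi 0 = false.
  by have := hc 0 0; rewrite addr0; case: (chi 0).
have chiB g h : chi (g - h) = chi g (+) chi h.
  have -> : - h = h by apply/eqP; rewrite eq_sym -addr_eq0 G_boolean.
  exact: hc.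
have fB : zmod_morphism f.
  move=> g h; rewrite /f chiB half_turnD; congr (_ + _).
  by apply/eqP; rewrite eq_sym eqr_oppLR -addr_eq0 -half_turnD addbb half_turn_false.
pose Phi : {additive G -> circle R} := HB.pack f
  (GRing.isZmodMorphism.Build _ _ f fB).
exists Phi => g; rewrite /binary -[Phi g]/(half_turn R (chi g)) -half_turn_false.
by rewrite (inj_eq (@half_turn_inj R)); case: (chi g).
Qed.

Definition represents a (x : T a) (u : ptree G) :=
  forall Phi, extension T Phi a x = half_turn R (value p (binary Phi) u).

Lemma represents_base g : represents (iu_base T g) (Leaf g).
Proof. by move=> Phi; rewrite (extends_base (extensionP T Phi)) binaryE. Qed.

Lemma represents_step a (a0 : (\bot < a)%O) (s : nat -> below T a) w :
  (forall n, represents (tagged (val (s n))) (w n)) ->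
  represents (iu_step T a0 (ult_class p (fun n => lim_class a0 (s n)))) (Node w).
Proof.
move=> sw Phi; have := @extends_step _ _ _ _ _ _ _ _ (extensionP T Phi) _ a0 s.
rewrite (_ : (fun n => _) = half_turn R \o (fun n => value p (binary Phi) (w n))); last first.
  by apply/funext => n; exact: sw.
move=> /circle_lim_unique; apply; apply/half_turn_cvg.
exact: (value_child p (binary Phi) (Node w)).
Qed.

Lemma bot_lt_top : (\bot < \top :> I)%O.
Proof.
rewrite lt0x; apply/eqP => e; apply: (@o1_top I).
rewrite (_ : [set _ | _] = set0) //.
by apply/seteqP; split=> // a /=; rewrite e ltx0.
Qed.

(** Otherwise omega_1 would be a countable union of countable initial segments. *)
Lemma omega1_regular (b : nat -> I) : (forall n, (b n < \top)%O) ->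
  exists2 c, (c < \top)%O & forall n, (b n < c)%O.
Proof.
move=> bt; apply: contrapT => no; apply: (@o1_top I).
have ct : countable (\bigcup_n [set a | (a < b n)%O] `|` range b).
  rewrite -bigcup2E; apply: bigcup_countable => // -[|[|k]] _ //=.
    by apply: bigcup_countable => // n _; exact: o1_lt_top.
  exact: sub_countable (card_image_le b setT) (countableP _).
apply: sub_countable ct; apply: subset_card_le => a /= at_.
apply: contrapT => nb; apply: no; exists a => // n.
rewrite ltNge le_eqVlt; apply/negP => /predU1P[ab|ab].
  by apply: nb; right; exists n.
by apply: nb; left; exists n.
Qed.

Lemma representation_exists a (x : T a) : exists u, represents x u.
Proof.
elim/(well_founded_ind (@o1_wf I)): a x => a IH x.
have [e|a0] := eqVneq a \bot%O.
  subst a; have [h _ hK] := iu_base_bij T; rewrite -(hK x).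
  by exists (Leaf (h x)); exact: represents_base.
rewrite -lt0x in a0; have [h _ hK] := iu_step_bij T a0.
have [f fE] := ult_classP (h x).
have /choice[w rw] : forall n, exists u, represents (tagged (val (repr (f n)))) u.
  by move=> n; apply: IH; exact: valP (repr (f n)).
exists (Node w); rewrite -(hK x) fE (_ : f = fun n => lim_class a0 (repr (f n))).
  exact: represents_step.
by apply/funext => n; rewrite /lim_class reprK.
Qed.

(** By induction on trees: the indices of the stages that realize the children of
    a node are bounded below omega_1, so the node is realized one stage after
    them and still below omega_1. *)
Lemma realization_below_top (u : ptree G) :
  exists2 b, (b < \top)%O & exists x : T b, represents x u.
Proof.
elim: u => [g|w IH].
  by exists \bot%O; [exact: bot_lt_top|exists (iu_base T g); exact: represents_base].
have /choice[s sP] : forall n, exists s : {b : I & T b}, (tag s < \top)%O /\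
    represents (tagged s) (w n).
  by move=> n; have [b bt [x xw]] := IH n; exists (existT (fun b => T b) b x).
have [c ct sc] := omega1_regular (fun n => (sP n).1).
have c0 : (\bot < c)%O by exact: le_lt_trans (le0x _) (sc 0%N).
pose s' n : below T c := exist (fun x : {b : I & T b} => (tag x < c)%O) (s n) (sc n).
exists c => //.
exists (iu_step T c0 (ult_class p (fun n => lim_class c0 (s' n)))).
by apply: represents_step => n; exact: (sP n).2.
Qed.

(** A tree realized at an earlier stage b is carried to omega_1 by the embedding,
    which represents it as a node with constant children. *)
Lemma realization (u : ptree G) : exists x : T \top%O, represents x u.
Proof.
have [b bt [x xu]] := realization_below_top u.
exists (demb T (ltW bt) x) => Phi; rewrite (iu_emb bt bot_lt_top).
have -> := represents_step (s := fun=> exist _ (existT (fun b => T b) b x) bt)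
  (w := fun=> u) bot_lt_top (fun=> xu) Phi.
by congr (half_turn R _); apply: value_node; apply: filterS filterT.
Qed.

End Characters.

(** * The topology of Ult *)

Section UltTopology.
Variables (R : realType) (p : omega_star) (G : zmodType) (I : omega1_closed).
Variable T : iterated_ultrapower p G I.
Implicit Types (Phi : {additive G -> circle R}) (x y : Ult R T).

Local Notation ext Phi := (@extension_top R p G I T Phi).

Definition ult_pi (x : T \top%O) : Ult R T := \pi_(Ult R T) (x : bohr R T).

(** The character induced on the quotient. Composing with a choice of
    representatives is harmless, as the extended characters are constant on the
    classes of their common kernel ([ult_charE]). *)
Definition ult_char Phi : Ult R T -> circle R := ext Phi \o repr.

Lemma ult_pi_eq (x y : bohr R T) : ult_pi x = ult_pi y <->
  forall Phi, ext Phi x = ext Phi y.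
Proof.
have extB Phi : ext Phi (x - y) = ext Phi x - ext Phi y.
  exact: (raddfB (extension T Phi \top%O)).
have piE : ult_pi x = ult_pi y <-> x - y \in bohr_ker R T.
  by rewrite Quotient.idealrBE; split=> [e|/eqP//]; apply/eqP.
rewrite piE; split=> [/asboolP k Phi|xy].
  by apply/eqP; rewrite -subr_eq0 -extB k.
by apply/asboolP => Phi; rewrite extB xy subrr.
Qed.

Lemma ult_charE Phi (x : T \top%O) : ult_char Phi (ult_pi x) = extension T Phi \top%O x.
Proof.
rewrite /ult_char /=; move: Phi; apply/ult_pi_eq.
by rewrite /ult_pi reprK.
Qed.

Lemma ult_piP x : exists y : T \top%O, x = ult_pi y.
Proof. by exists (repr x); rewrite /ult_pi reprK. Qed.

Lemma ult_piD (x y : T \top%O) : ult_pi (x + y) = ult_pi x + ult_pi y.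
Proof. exact: (@Quotient.pi_add _ (bohr_ker R T)). Qed.

Lemma ult_charD Phi x y : ult_char Phi (x + y) = ult_char Phi x + ult_char Phi y.
Proof.
have [x' ->] := ult_piP x; have [y' ->] := ult_piP y.
by rewrite -ult_piD !ult_charE raddfD.
Qed.

Lemma ult_char0 Phi : ult_char Phi 0 = 0.
Proof. by apply: (addrI (ult_char Phi 0)); rewrite -ult_charD !addr0. Qed.

Lemma ult_char_separates x y :
  (forall Phi, ult_char Phi x = ult_char Phi y) -> x = y.
Proof.
have [x' ->] := ult_piP x; have [y' ->] := ult_piP y => e.
by apply/ult_pi_eq => Phi; have := e Phi; rewrite !ult_charE.
Qed.

Lemma extension_top_continuous Phi : continuous (ext Phi : bohr R T -> circle R).
Proof.
move=> x; have /cvg_sup/(_ Phi) := @cvg_id _ (nbhs (x : bohr R T)).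
move=> xx A Ax.
exact: (xx _ (@initial_continuous _ _ (ext Phi) x A Ax)).
Qed.

Lemma ult_char_continuous Phi : continuous (ult_char Phi).
Proof.
apply: repr_comp_continuous; first exact: extension_top_continuous.
by move=> x y /eqP/ult_pi_eq e; apply/eqP.
Qed.

Lemma bohr_cvg (F : set_system (bohr R T)) (x : bohr R T) : Filter F ->
  (forall Phi, ext Phi @ F --> ext Phi x) -> F --> x.
Proof.
move=> FF Fx; apply/cvg_sup => Phi A /=.
rewrite (@nbhsE (initial_topology (ext Phi))).
move=> [B [[W oW <-] Wx] BA]; apply: filterS BA _.
by apply: (Fx Phi); apply: open_nbhs_nbhs.
Qed.

(** The quotient topology is still the one induced by the characters: the filter F
    is the image under the quotient map of its image under the choice of
    representatives, and the latter converges in the initial topology. *)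
Lemma ult_cvg (F : set_system (Ult R T)) x : Filter F ->
  (forall Phi, ult_char Phi @ F --> ult_char Phi x) -> F --> x.
Proof.
move=> FF Fx.
have rx : (repr : Ult R T -> bohr R T) @ F --> (repr x : bohr R T) by exact: bohr_cvg.
have reprK' z : ult_pi (repr z) = z by rewrite /ult_pi reprK.
have pix : ult_pi y @[y --> (repr : Ult R T -> bohr R T) @ F] --> ult_pi (repr x).
  exact: cvg_trans (cvg_app _ rx) (@pi_continuous _ _ (repr x)).
rewrite -[X in _ --> X]reprK'; apply: cvg_trans pix => A /= FA.
by apply: (@filterS _ F) FA => z Az; rewrite -[z]reprK'.
Qed.

Lemma ult_hausdorff : hausdorff_space (Ult R T).
Proof.
move=> x y xy; apply: ult_char_separates => Phi.
apply: (@circle_hausdorff R) => A B Ax By.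
have [z [Az Bz]] := xy _ _ (ult_char_continuous Ax) (ult_char_continuous By).
by exists (ult_char Phi z).
Qed.

Lemma ult_add_continuous : continuous (fun z : Ult R T * Ult R T => z.1 + z.2).
Proof.
move=> [x y]; apply: ult_cvg => Phi.
have sumE : ult_char Phi \o (fun z => z.1 + z.2) =
    fun z => ult_char Phi z.1 + ult_char Phi z.2.
  by apply/funext => z; rewrite /= ult_charD.
suff : ult_char Phi z.1 + ult_char Phi z.2 @[z --> (x, y)]
    --> ult_char Phi x + ult_char Phi y.
  by rewrite -sumE -ult_charD.
apply: (continuous2_cvg _ (h := fun u v => u + v)).
- exact: (@circle_add_continuous R (ult_char Phi x, ult_char Phi y)).
- exact: (cvg_comp _ _ (@cvg_fst _ _ (nbhs x) (nbhs y) _) (@ult_char_continuous Phi x)).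
- exact: (cvg_comp _ _ (@cvg_snd _ _ (nbhs x) (nbhs y) _) (@ult_char_continuous Phi y)).
Qed.

Hypothesis G_boolean : forall g : G, g + g = 0.

Lemma ult_boolean : boolean_group (Ult R T).
Proof.
move=> x; have xx : x + x = 0.
  apply: ult_char_separates => Phi.
  have [y ->] := ult_piP x; have [u yu] := representation_exists R G_boolean y.
  by rewrite ult_charD ult_charE yu -half_turnD addbb half_turn_false ult_char0.
by apply/eqP; rewrite eq_sym -addr_eq0 xx.
Qed.

Lemma ult_p_compact : p_compact p (Ult R T).
Proof.
move=> x; have /choice[w xw] : forall n, exists u, forall Phi,
    ult_char Phi (x n) = half_turn R (value p (binary Phi) u).
  move=> n; have [y ->] := ult_piP (x n).
  have [u yu] := representation_exists R G_boolean y.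
  by exists u => Phi; rewrite ult_charE yu.
have [y yw] := realization R G_boolean T (Node w).
exists (ult_pi y); apply: ult_cvg => Phi; rewrite ult_charE yw.
suff : ult_char Phi \o x @ ultra p --> half_turn R (value p (binary Phi) (Node w)) by [].
rewrite (_ : _ \o x = half_turn R \o (fun n => value p (binary Phi) (w n))).
  by apply/half_turn_cvg; exact: (value_child p (binary Phi) (Node w)).
by apply/funext => n; rewrite /= xw.
Qed.

Variable r : nat -> G.
Hypothesis r_surj : forall g, exists m, r m = g.

(** The differences x_n - l are represented by trees t_n. Their convergence to 0
    says that each character vanishes on almost all t_n, so by
    [no_null_sequence] all characters vanish together on almost all t_n, and as
    they separate points, x_n = l for these n. *)
Lemma ult_no_convergent_sequence : selective p ->
  no_nontrivial_convergent_sequence (Ult R T).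
Proof.
move=> sel x l xl.
have xl0 : (fun n => x n - l) @ \oo --> (0 : Ult R T).
  rewrite -(subrr l); apply: (continuous2_cvg _ (h := fun u v => u + v)) xl (cvg_cst _).
  exact: (@ult_add_continuous (l, - l)).
have /choice[t tP] : forall n, exists u, forall Phi,
    ult_char Phi (x n - l) = half_turn R (value p (binary Phi) u).
  move=> n; have [y ->] := ult_piP (x n - l).
  have [u yu] := representation_exists R G_boolean y.
  by exists u => Phi; rewrite ult_charE yu.
have char0 Phi : ult_char Phi 0 = half_turn R false.
  by rewrite ult_char0 half_turn_false.
have t_null chi : character chi -> \forall i \near \oo, value p chi (t i) = false.
  move=> /(character_lift R G_boolean)[Phi /funext <-].
  apply/(@half_turn_cvg R nat \oo); rewrite -(char0 Phi).
  rewrite (_ : _ \o _ = ult_char Phi \o (fun n => x n - l)).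
    exact: (cvg_comp _ _ xl0 (@ult_char_continuous Phi 0)).
  by apply/funext => n /=; rewrite tP.
exists l; apply: contrapT => nl.
apply: (no_null_sequence r_surj t_null _ sel) => k.
apply: contrapT => no; apply: nl; exists k => // n /= kn.
apply/eqP; rewrite -subr_eq0; apply/eqP/ult_char_separates => Phi.
rewrite tP char0; congr (half_turn R _); apply/negbTE/negP => tn.
by apply: no; exists n, (binary Phi); split=> //; exact: binary_character.
Qed.

End UltTopology.

(** * The group of finite subsets of omega *)

Lemma fin_omega_addrr (A : fin_omega) : A + A = 0.
Proof. exact: symdiffN. Qed.

Lemma fin_omega_enumeration : exists r : nat -> fin_omega, forall A, exists m, r m = A.
Proof.
exists (fun m => [fset n in odflt [::] (choice.unpickle m : option (seq nat))]%fset) => A.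
exists (choice.pickle (enum_fset A)); rewrite choice.pickleK.
by apply/fsetP => n; rewrite !inE.
Qed.

Theorem theorem3p4 (R : realType) (I : omega1_closed) (p : omega_star)
    (T : iterated_ultrapower p fin_omega I) :
  selective p ->
  [/\ hausdorff_space (Ult R T),
      p_compact p (Ult R T),
      topological_group (Ult R T),
      boolean_group (Ult R T) &
      no_nontrivial_convergent_sequence (Ult R T)].
Proof.
move=> sel; have boolean := ult_boolean (R := R) (T := T) fin_omega_addrr.
have [r r_surj] := fin_omega_enumeration.
split=> //; first exact: ult_hausdorff.
- exact: ult_p_compact fin_omega_addrr.
- split; first exact: ult_add_continuous.
  by rewrite (_ : -%R = id); [move=> x; exact: cvg_id|apply/funext].
- exact: (ult_no_convergent_sequence fin_omega_addrr r_surj sel).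
Qed.
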